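(* Let $A$ be an algebra generated by a linear subspace $V\subseteq A$, let $q$ be a Hilbertian seminorm on $V$ such that $\{\alpha\in X(A):\alpha\restriction_V\text{ is }q\text{-continuous}\}\neq\emptyset$, and let $J:=\{\langle W\rangle: W\text{ finite dimensional subspace of }V\}$. Let $L$ be a normalized linear functional on $A$. Then there exists a representing Radon measure $\nu$ for $L$ with support contained in $\{\alpha\in X(A):\alpha\restriction_V\text{ is }q\text{-continuous}\}$ if and only if there exists a Hilbertian seminorm $p$ on $V$ with $\mathrm{tr}(p/q)<\infty$ and for each $S\in J$ there exists a representing Radon measure $\nu_S$ for $L\restriction_S$ with support contained in $X(S)$ and such that $\{\nu_S:S\in J\}$ is $p$-concentrated.
   Context: Algebras are unital commutative $\mathbb{R}$-algebras (not necessarily finitely generated). For an algebra $A$, the character space $X(A)$ is the set of all $\mathbb{R}$-algebra homomorphisms $A\to\mathbb{R}$; it is assumed non-empty and carries the weakest topology making all maps $\hat a:X(A)\to\mathbb{R}$, $\hat a(\alpha)=\alpha(a)$ ($a\in A$), continuous, and its Borel $\sigma$-algebra. $A$ is generated by a linear subspace $V$ if $V$ contains a set of generators of $A$; $\langle W\rangle$ is the subalgebra of $A$ generated by $W$. A linear functional $L:A\to\mathbb{R}$ is normalized if $L(1)=1$. A Radon measure is a non-negative Borel measure that is locally finite and inner regular with respect to compact sets. The support of a Radon measure $\nu$ on $X(A)$ is the smallest closed subset $C$ of $X(A)$ for which $\nu(X(A)\setminus C)=0$. A representing Radon measure for a linear functional $L$ on $A$ is a Radon measure $\nu$ on $X(A)$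 with $L(a)=\int_{X(A)}\hat a\,d\nu$ for all $a\in A$ (analogously for $S\in J$ and $X(S)$). A seminorm $p$ on a real vector space is Hilbertian if $p(v)=\sqrt{\langle v,v\rangle_p}$ for a (necessarily unique) symmetric positive semidefinite bilinear form $\langle\cdot,\cdot\rangle_p$. A linear functional $l$ on $V$ is $q$-continuous if, for some $C>0$, $|l(v)|\le Cq(v)$ for all $v\in V$. For Hilbertian seminorms $p,q$ on $V$, $\mathrm{tr}(p/q):=\sup_E\sum_{e\in E}p(e)^2$ over all finite $q$-orthonormal subsets $E\subseteq V$ if $\ker(q)\subseteq\ker(p)$, and $\mathrm{tr}(p/q):=\infty$ otherwise. With $B_\delta(p):=\{v\in V:p(v)\le\delta\}$, a family of Radon measures $\nu_S$ on $X(S)$, $S\in J$, is $p$-concentrated if for every $\varepsilon>0$ there is $\delta>0$ such that $\nu_S(\{\alpha\in X(S):|\alpha(a)|\ge 1\})\le\varepsilon$ for all $S\in J$ and all $a\in B_\delta(p)\cap S$.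
   Formalization: ''Support contained in'' the set of q-continuous characters is read as: the complement of that set is a ν-null set. The set need not be closed, and with the smallest closed support the ''if'' direction fails (A=V=R[X], q the l2 norm of coefficients, L = normalized integral over [-1,1]). *)

(* Defs.v *)
From HB Require Import structures.
From mathcomp Require Import all_boot all_order all_algebra finmap.
From mathcomp Require Import all_classical all_reals all_analysis.

Set Implicit Arguments.
Unset Strict Implicit.
Unset Printing Implicit Defensive.

Import Order.TTheory GRing.Theory Num.Theory.
Import numFieldNormedType.Exports.

Local Open Scope classical_set_scope.
Local Open Scope ring_scope.

Record subspace_of (R : realType) (A : lmodType R) (V : submodClosed A) :=
  SubspaceOf { subspace_val : A; _ : subspace_val \in V }.

Section SubspaceInstances.
Variables (R : realType) (A : lmodType R) (V : submodClosed A).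
HB.instance Definition _ := [isSub for @subspace_val R A V].
HB.instance Definition _ := [Choice of subspace_of V by <:].
HB.instance Definition _ := [SubChoice_isSubLmodule of subspace_of V by <:].
End SubspaceInstances.

Definition finite_dim (R : realType) (A : lmodType R) (W : submodClosed A) :=
  exists2 s : seq A, {subset s <= W} &
    forall w, w \in W ->
      exists c : 'I_(size s) -> R, w = \sum_(i < size s) c i *: s`_i.

Record subalgebra_of (R : realType) (A : comAlgType R) (S : subalgClosed A) :=
  SubalgebraOf { subalgebra_val : A; _ : subalgebra_val \in S }.

Section SubalgebraInstances.
Variables (R : realType) (A : comAlgType R) (S : subalgClosed A).
HB.instance Definition _ := [isSub for @subalgebra_val R A S].
HB.instance Definition _ := [Choice of subalgebra_of S by <:].
HB.instance Definition _ :=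
  GRing.SubChoice_isSubComNzRing.Build A (mem S) (subalgebra_of S)
    (subalgClosedP S).
HB.instance Definition _ :=
  GRing.SubZmodule_isSubLmodule.Build R A (mem S) (subalgebra_of S)
    (subalgClosedP S).
HB.instance Definition _ :=
  GRing.SubNzRing_SubLmodule_isSubLalgebra.Build R A (mem S) (subalgebra_of S).
HB.instance Definition _ :=
  GRing.SubLalgebra_isSubAlgebra.Build R A (mem S) (subalgebra_of S).

Definition subalgebra_incl (a : subalgebra_of S) : A := val a.
HB.instance Definition _ := GRing.RMorphism.copy subalgebra_incl
  (val : {rmorphism subalgebra_of S -> A}).
HB.instance Definition _ := GRing.Linear.copy subalgebra_incl
  (val : {linear subalgebra_of S -> A}).
End SubalgebraInstances.

Section GeneratedSubalgebra.
Variables (R : realType) (A : comAlgType R) (G : set A).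

Definition gen_subalg_pred : {pred A} :=
  [in smallest (fun M : set A => subalg_closed [in M]) G].

Lemma gen_subalg_closed : subalg_closed gen_subalg_pred.
Proof.
split.
- by apply/mem_set => M [[M1 _ _] _]; exact/set_mem.
- move=> a u v /set_mem Gu /set_mem Gv; apply/mem_set => M [[M1 Ml Mm] GM].
  by apply/set_mem/Ml; apply/mem_set; [exact: Gu | exact: Gv].
- move=> u v /set_mem Gu /set_mem Gv; apply/mem_set => M [[M1 Ml Mm] GM].
  by apply/set_mem/Mm; apply/mem_set; [exact: Gu | exact: Gv].
Qed.

HB.instance Definition _ :=
  GRing.isSubalgClosed.Build R A gen_subalg_pred gen_subalg_closed.

Definition gen_subalg : subalgClosed A := gen_subalg_pred.

End GeneratedSubalgebra.

Definition generated_by (R : realType) (A : comAlgType R) (V : set A) :=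
  exists2 G : set A, G `<=` V & forall a : A, a \in gen_subalg G.

Definition fin_gen_subalgs (R : realType) (A : comAlgType R)
    (V : submodClosed A) : set (subalgClosed A) :=
  [set gen_subalg [set` W] | W in
     [set W : submodClosed A | {subset W <= V} /\ finite_dim W]].

Definition character (R : realType) (A : comAlgType R) :=
  {lrmorphism A -> R | *%R}.

Definition char_res (R : realType) (A : comAlgType R) (S : subalgClosed A)
  (x : character A) : character (subalgebra_of S) :=
  (x : {lrmorphism A -> R | *%R}) \o @subalgebra_incl R A S.

(* X(A); the parameter x0 only witnesses that X(A) is non-empty, which the
   measurable structures of the library require of their carrier. *)
Definition charspace (R : realType) (A : comAlgType R) (x0 : character A) :=
  character A.

Definition hat (R : realType) (A : comAlgType R) (x0 : character A) (a : A)
  (x : charspace x0) : R := (x : character A) a.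
Arguments hat {R A} x0 a x.

Section CharacterSpace.
Variables (R : realType) (A : comAlgType R) (x0 : character A).

HB.instance Definition _ := gen_eqMixin (charspace x0).
HB.instance Definition _ := gen_choiceMixin (charspace x0).

Definition charspace_topology := sup_topology (fun a : A =>
  Topological.class (initial_topology (hat x0 a))).

HB.instance Definition _ :=
  Topological.copy (charspace x0) charspace_topology.
HB.instance Definition _ := isPointed.Build (charspace x0) x0.

Lemma charP (x y : charspace x0) :
  (forall a, hat x0 a x = hat x0 a y) -> x = y.
Proof.
case: x y => [f Cf] [g Cg] /= h.
have E : f = g by apply/funext => a; exact: h.
subst g; congr GRing.LRMorphism.Pack.
case: Cf Cg => [[a1] [a2] [a3]] [[b1] [b2] [b3]].
congr GRing.LRMorphism.Class; congr (_ _); exact: Prop_irrelevance.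
Qed.

Lemma hat_continuous a : continuous (hat x0 a).
Proof.
move=> x; pose X (b : A) := Topological.class (initial_topology (hat x0 b)).
apply: cvg_trans (@initial_continuous _ _ (hat x0 a) x).
apply: cvg_app.
have /(_ (nbhs_filter _)) := @cvg_sup _ _ X (nbhs (x : charspace x0)) x.
move=> [h _]; exact: h.
Qed.

Lemma charspace_hausdorff : hausdorff_space (charspace x0).
Proof.
move=> x y clxy; apply: charP => a.
apply: (@Rhausdorff R); move=> U V Ux Vy.
have := clxy _ _ (hat_continuous Ux) (hat_continuous Vy).
by case=> z [? ?]; exists (hat x0 a z).
Qed.

End CharacterSpace.

Definition borel (T : ptopologicalType) := g_sigma_algebraType (@open T).

Section RadonMeasures.
Variables (R : realType) (T : ptopologicalType).
Implicit Types (mu : {measure set (borel T) -> \bar R}) (Y : set T).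

Definition locally_finite mu :=
  forall x : T, exists2 U : set T, open_nbhs x U & (mu U < +oo)%E.

Definition compact_inner_regular mu :=
  forall B : set (borel T), measurable B ->
    mu B = ereal_sup [set mu K | K in [set K : set T | compact K /\ K `<=` B]].

Definition radon mu := locally_finite mu /\ compact_inner_regular mu.

Definition msupport mu : set T :=
  smallest (fun C : set T => closed C /\ mu (~` C) = 0%E) set0.

(* For closed Y this is the inclusion of msupport mu, the smallest closed set
   with null complement, in Y (supported_in_closed below).  The set
   continuous_chars below is sigma-compact but in general not closed, and then
   the inclusion of msupport mu is too strong: for A = V = R[X] with q the l2
   norm of the coefficients, X(A) is the real line and continuous_chars is
   ]-1, 1[; it carries Lebesgue measure on [-1, 1], whose smallest closed
   support is [-1, 1]. *)
Definition supported_in mu Y := mu.-negligible (~` Y).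

Lemma closed_msupport mu : closed (msupport mu).
Proof. by apply: closed_bigI => C [[]]. Qed.

Lemma msupportC0 mu : hausdorff_space T -> radon mu ->
  mu (~` msupport mu) = 0%E.
Proof.
move=> hT [_ inr].
have mC : measurable (~` msupport mu : set (borel T)).
  by apply: sub_sigma_algebra; exact: closed_openC (@closed_msupport mu).
rewrite inr//; apply/eqP; rewrite eq_le; apply/andP; split; last first.
  apply: ereal_sup_ubound => /=; exists set0; last by rewrite measure0.
  by split => //; exact: compact0.
apply: ge_ereal_sup => _ [K [cK KsC] <-].
have mK : measurable (K : set (borel T)).
  rewrite -(setCK K); apply: measurableC; apply: sub_sigma_algebra.
  exact: closed_openC (compact_closed hT cK).
move: cK; rewrite compact_cover.
pose D := [set C : set T | closed C /\ mu (~` C) = 0%E].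
move=> /(_ (set T) D (fun C => ~` C)) [].
- by move=> C [cC _]; exact: closed_openC.
- move=> x /KsC nx; apply: contrapT => nC; apply: nx => C [[cC C0] _].
  by apply: contrapT => nCx; apply: nC; exists C.
move=> E ED KE.
have Dfin : finite_set [set` E] by exact: finite_fset.
apply: (le_trans (content_sub_fsum mu Dfin _ mK KE)).
  move=> C /= /ED /set_mem [cC _]; apply: sub_sigma_algebra.
  exact: closed_openC.
by rewrite fsbig1// => C /= /ED /set_mem [].
Qed.

Lemma supported_in_closed mu Y : hausdorff_space T -> radon mu -> closed Y ->
  supported_in mu Y <-> msupport mu `<=` Y.
Proof.
move=> hT rmu cY; split => [muY | sY].
  suff Y0 : mu (~` Y) = 0%E by move=> x; apply; split.
  apply: measure_negligible muY.
  by apply: sub_sigma_algebra; exact: closed_openC cY.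
exists (~` msupport mu); split; last exact: subsetC.
- by apply: sub_sigma_algebra; exact: closed_openC (@closed_msupport mu).
- exact: msupportC0.
Qed.

End RadonMeasures.

Definition representing (R : realType) (A : comAlgType R) (x0 : character A)
    (nu : {measure set (borel (charspace x0)) -> \bar R}) (L : A -> R) :=
  forall a : A,
    nu.-integrable setT (EFin \o hat x0 a) /\
    (\int[nu]_x (hat x0 a x)%:E)%E = (L a)%:E.

Record hilbertian_seminorm (R : realType) (U : lmodType R) :=
  HilbertianSeminorm {
    hnorm :> U -> R;
    hform : {biscalar U};
    hform_sym : forall u v, hform u v = hform v u;
    hform_ge0 : forall v, 0 <= hform v v;
    hnormE : forall v, hnorm v = Num.sqrt (hform v v)
  }.

Section Seminorms.
Variables (R : realType) (U : lmodType R).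
Implicit Types p q : hilbertian_seminorm U.

Definition orthonormal q (E : {fset U}) :=
  {in E &, forall u v, hform q u v = (u == v)%:R}.

Definition seminorm_trace p q : \bar R :=
  if `[< forall v, q v = 0 -> p v = 0 >] then
    ereal_sup [set (\sum_(e <- E) p e ^+ 2)%:E | E in orthonormal q]
  else +oo%E.

Definition seminorm_continuous q (l : U -> R) :=
  exists2 C : R, 0 < C & forall v, `|l v| <= C * q v.

End Seminorms.

Definition concentrated (R : realType) (A : comAlgType R) (V : submodClosed A)
    (x0 : character A) (J : set (subalgClosed A))
    (p : hilbertian_seminorm (subspace_of V))
    (nu : forall S : subalgClosed A,
       {measure set (borel (charspace (char_res S x0))) -> \bar R}) :=
  forall e : R, 0 < e -> exists2 d : R, 0 < d &
    forall S, J S ->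
    forall (v : subspace_of V) (a : subalgebra_of S), val v = val a ->
      p v <= d ->
      (nu S [set x | (1 <= `|hat (char_res S x0) a x|)%R] <= e%:E)%E.

Definition continuous_chars (R : realType) (A : comAlgType R)
    (V : submodClosed A) (q : hilbertian_seminorm (subspace_of V))
    (x0 : character A) : set (charspace x0) :=
  [set x | seminorm_continuous q (fun v => hat x0 (val v) x)].
Arguments continuous_chars {R A V} q x0.

(* Main.v *)
Require Import Defs.
From HB Require Import structures.
From mathcomp Require Import all_boot all_order all_algebra finmap.
From mathcomp Require Import all_classical all_reals all_analysis.
From mathcomp Require Import measurable_realfun.
From mathcomp Require Import lra.

Set Implicit Arguments.
Unset Strict Implicit.
Unset Printing Implicit Defensive.

Import Order.TTheory GRing.Theory Num.Theory.
Import numFieldNormedType.Exports.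

Local Open Scope classical_set_scope.
Local Open Scope ring_scope.

(** Let p be a Hilbertian seminorm of finite trace relative to q.  A random
    linear functional on V that is small in probability on p-balls is almost
    surely q-continuous: on a q-orthonormal family E, the sum of the squares of
    the values is tested against random signs.  The signed sums have p-norm of
    mean square the trace of p over E, hence take small values with high
    probability, while a fixed proportion of the signs gives a value comparable
    with the root of the sum of squares (sum_sqr_bound).  With Gram-Schmidt
    this bounds, uniformly in the finitely generated subalgebra S, the
    probability that a character of S exceeds r q somewhere on V (escape_bound).

    The measures on the character spaces X(S) need not be compatible with one
    another, so there is no projective system to take a limit of.  Instead they
    are moved to the space of all real functions on the algebra (transfer), and
    their values on Borel sets are passed to the limit along an ultrafilter on
    the subalgebras.  The limit is only finitely additive, but functions bounded
    on V by r q are bounded at every element of the algebra, so it is tight, and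
    a tight finitely additive function on the Borel sets of a regular Hausdorff
    space is turned into a Radon measure by inner approximation of open sets by
    compact sets (content_to_radon, ultra_radon).  Inner regularity makes
    uncountable unions of open null sets null; therefore almost every function
    is a character, and one that is q-continuous on V.

    Upper bounds on open sets suffice for the moments: they bound the second
    moment of every a by L (a ^ 2), and applying this to a + t.1 for all real t
    forces the first moments to be those of L (second_moments_representing).

    In the other direction, a Radon measure on the q-continuous characters is
    given the weight w, comparable with the inverse square of the norm of a
    character as a functional on (V, q).  The weighted L2-norm on V is a
    Hilbertian seminorm p; Bessel's inequality bounds its trace by the total
    mass, and Chebyshev's inequality on the balls, where w is bounded below,
    gives concentration of the images of the measure on the X(S). *)

(** * Radon measures from finitely additive set functions *)

Lemma compact_shrink (T : ptopologicalType) (K U : set T) :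
  regular_space T -> compact K -> open U -> K `<=` U ->
  exists O : set T, [/\ open O, K `<=` O & closure O `<=` U].
Proof.
move=> rT; rewrite compact_cover => cK oU KU.
pose D := [set O : set T | open O /\ closure O `<=` U].
have [||E ED KE] := cK (set T) D id.
- by move=> O [].
- move=> x /KU Ux; have nU : nbhs x U by exact: open_nbhs_nbhs.
  have [B nB cBU] := rT x _ nU.
  exists B°; last exact: nB.
  split; first exact: open_interior.
  by apply: subset_trans cBU; apply: closureS; exact: interior_subset.
exists (\bigcup_(O in [set` E]) O); split => //.
  by apply: bigcup_open => O /= /ED /set_mem [].
apply: (@subset_trans _ (\bigcup_(O in [set` E]) closure O)); last first.
  by move=> x [Z /= /ED /set_mem [_]]; apply.
rewrite [X in _ `<=` X](closure_id _).1; last first.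
  by apply: closed_bigcup => [|O _]; [exact: finite_fset|exact: closed_closure].
by apply: closureS; apply: subset_bigcup => O _; exact: subset_closure.
Qed.

Lemma compact_split (T : ptopologicalType) (K U V : set T) :
  hausdorff_space T -> regular_space T -> compact K -> open U -> open V ->
  K `<=` U `|` V ->
  exists K1 K2, [/\ compact K1, compact K2, K = K1 `|` K2, K1 `<=` U & K2 `<=` V].
Proof.
move=> hT rT cK oU oV KUV.
have clK : closed K by exact: compact_closed.
have [||O [oO KO OU]] := @compact_shrink T (K `\` V) U rT _ oU.
- by apply: (subclosed_compact _ cK) => //; apply: closedI => //; exact: open_closedC.
- by move=> x [/KUV []].
exists (K `&` closure O), (K `\` O); split.
- by apply: (subclosed_compact _ cK) => //; apply: closedI => //; exact: closed_closure.
- by apply: (subclosed_compact _ cK) => //; apply: closedI => //; exact: open_closedC.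
- apply/seteqP; split => x; last by move=> [[]|[]].
  move=> Kx; have [Ox|nOx] := pselect (O x); last by right.
  by left; split => //; exact: subset_closure.
- by move=> x [_ /OU].
- move=> x [Kx nO]; have [//|nV] := pselect (V x).
  by exfalso; apply: nO; exact: KO.
Qed.

Section BorelSets.
Variable T : ptopologicalType.

Lemma borel_open (U : set T) : open U -> measurable (U : set (borel T)).
Proof. by move=> oU; exact: sub_sigma_algebra. Qed.

Lemma borel_closed (C : set T) : closed C -> measurable (C : set (borel T)).
Proof.
move=> cC; rewrite -(setCK C); apply: (@measurableC _ (borel T)).
by apply: borel_open; exact: closed_openC.
Qed.

Lemma borel_compact (K : set T) :
  hausdorff_space T -> compact K -> measurable (K : set (borel T)).
Proof. by move=> hT cK; exact: borel_closed (compact_closed hT cK). Qed.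

End BorelSets.

Section ContentToRadon.
Variables (R : realType) (T : ptopologicalType) (m : set T -> R).
Hypotheses (hT : hausdorff_space T) (rT : regular_space T).
Hypotheses (m_ge0 : forall B : set (borel T), measurable B -> 0 <= m B)
  (mU : forall B C : set (borel T), measurable B -> measurable C ->
     B `&` C = set0 -> m (B `|` C) = m B + m C)
  (m_tight : forall e : R, 0 < e -> exists2 K, compact K & m setT - e <= m K).

Local Notation mble B := (measurable (B : set (borel T))).
Let compact_mble K := @borel_compact T K hT.

Lemma content0 : m set0 = 0.
Proof.
have /eqP := mU measurable0 measurable0 (setI0 set0).
by rewrite setU0 -subr_eq0 opprD addrA subrr add0r oppr_eq0 => /eqP.
Qed.

Lemma content_le B C : mble B -> mble C -> B `<=` C -> m B <= m C.
Proof.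
move=> mB mC BC.
have mCB : mble (C `\` B) by exact: measurableD.
rewrite -(setDUK BC) mU ?lerDl ?m_ge0//.
by rewrite setDE setICA setICr setI0.
Qed.

Lemma content_subadd B C : mble B -> mble C -> m (B `|` C) <= m B + m C.
Proof.
move=> mB mC; rewrite (_ : B `|` C = B `|` (C `\` B)).
  rewrite mU//; [|exact: measurableD|by rewrite setDE setICA setICr setI0].
  by rewrite lerD2l; apply: content_le => //; exact: measurableD.
apply/seteqP; split => x [Bx|]; [by left| |by left|by move=> []; right].
by move=> Cx; have [Bx|nB] := pselect (B x); [left|right].
Qed.

(** Only compact subsets of U are measured: they meet finitely many members of
    an open cover, which makes inner countably subadditive on open sets although
    the content is only finitely additive. *)
Definition inner (U : set T) : \bar R :=
  ereal_sup [set (m K)%:E | K in [set K | compact K /\ K `<=` U]].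

Definition outer (E : set T) : \bar R :=
  ereal_inf [set inner U | U in [set U | open U /\ E `<=` U]].

Lemma inner_ub K U : compact K -> K `<=` U -> ((m K)%:E <= inner U)%E.
Proof. by move=> cK KU; apply: ereal_sup_ubound; exists K. Qed.

Lemma inner_ge0 U : (0 <= inner U)%E.
Proof.
by apply: le_trans (inner_ub compact0 (@sub0set _ U)); rewrite content0.
Qed.

Lemma inner_le U V : U `<=` V -> (inner U <= inner V)%E.
Proof.
move=> UV; apply: ge_ereal_sup => _ [K [cK KU] <-].
by apply: inner_ub => //; exact: subset_trans UV.
Qed.

Lemma inner_le_content U : open U -> (inner U <= (m U)%:E)%E.
Proof.
move=> oU; apply: ge_ereal_sup => _ [K [cK KU] <-]; rewrite lee_fin.
by apply: content_le => //; [exact: compact_mble|exact: borel_open].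
Qed.

Lemma inner0 : inner set0 = 0%E.
Proof.
apply/eqP; rewrite eq_le inner_ge0 andbT.
by have := inner_le_content open0; rewrite content0.
Qed.

(** Subadditivity over an open cover: a compact set is cut into compact pieces,
    each inside one member of the cover. *)
Lemma inner_fin_cover (U : nat -> set T) n K : (forall i, open (U i)) ->
  compact K -> K `<=` \bigcup_(i in `I_n) U i ->
  ((m K)%:E <= \sum_(i < n) inner (U i))%E.
Proof.
move=> oU; elim: n K => [|n IHn] K cK.
  by rewrite big_ord0 II0 bigcup_set0 subset0 => ->; rewrite content0.
rewrite IISl bigcup_setU1 setUC => /(compact_split hT rT cK).
case=> //; first by apply: bigcup_open => i _; exact: oU.
move=> K1 [K2 [cK1 cK2 -> KU1 KU2]]; rewrite big_ord_recr/=.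
apply: (@le_trans _ _ ((m K1)%:E + (m K2)%:E)%E).
  by rewrite -EFinD lee_fin content_subadd//; exact: compact_mble.
by apply: leeD; [exact: IHn|exact: inner_ub].
Qed.

Lemma inner_sigma_subadd (U : nat -> set T) : (forall i, open (U i)) ->
  (inner (\bigcup_i U i) <= \sum_(i <oo) inner (U i))%E.
Proof.
move=> oU; apply: ge_ereal_sup => _ [K [cK KU] <-].
have := cK; rewrite compact_cover => /(_ nat setT U).
case=> // E _ KE.
apply: (@le_trans _ _ (\sum_(i < (\max_(i <- E) i).+1) inner (U i))%E).
  apply: inner_fin_cover => //; apply: subset_trans KE _ => x [i /= iE Uix].
  by exists i => //=; rewrite ltnS; exact: leq_bigmax_seq.
rewrite -(big_mkord xpredT (fun i => inner (U i))).
by apply: nneseries_lim_ge => i _ _; exact: inner_ge0.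
Qed.

Lemma outer_open U : open U -> outer U = inner U.
Proof.
move=> oU; apply/eqP; rewrite eq_le; apply/andP; split.
  by apply: ereal_inf_lbound; exists U => //; split.
by apply: le_ereal_inf_tmp => _ [V [oV UV] <-]; exact: inner_le.
Qed.

Lemma outer_ge0 E : (0 <= outer E)%E.
Proof. by apply: le_ereal_inf_tmp => _ [V _ <-]; exact: inner_ge0. Qed.

Lemma outer0 : outer set0 = 0%E.
Proof. by rewrite outer_open ?inner0//; exact: open0. Qed.

Lemma outer_le E F : E `<=` F -> (outer E <= outer F)%E.
Proof.
move=> EF; apply: le_ereal_inf_tmp => _ [V [oV FV] <-].
by apply: ereal_inf_lbound; exists V => //; split => //; exact: subset_trans FV.
Qed.

Lemma outer_fin E : outer E \is a fin_num.
Proof.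
rewrite ge0_fin_numE ?outer_ge0//.
apply: (@le_lt_trans _ _ (outer setT)); first exact: outer_le.
rewrite outer_open; last exact: openT.
by apply: le_lt_trans (inner_le_content openT) _; exact: ltry.
Qed.

Lemma outer_approx E e : 0 < e ->
  exists2 U, open U /\ E `<=` U & (inner U <= outer E + e%:E)%E.
Proof.
move=> e0; have [_ [U [oU EU] <-] h] := lb_ereal_inf_adherent e0 (outer_fin E).
by exists U => //; exact: ltW.
Qed.

Lemma outer_sigma_subadd : sigma_subadditive outer.
Proof.
move=> F; apply/lee_addgt0Pr => e e0.
have ek n : 0 < e / (2 ^ n.+1)%:R by rewrite divr_gt0// ltr0n expn_gt0.
have [U hU] := choice (fun n => (exists2P _ _).1 (outer_approx (F n) (ek n))).
apply: le_trans (epsilon_trick xpredT (fun n => outer_ge0 (F n)) (ltW e0)).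
apply: (@le_trans _ _ (inner (\bigcup_n U n))).
  rewrite -outer_open; last by apply: bigcup_open => i _; have [[]] := hU i.
  by apply: outer_le; apply: subset_bigcup => i _; have [[]] := hU i.
apply: le_trans (inner_sigma_subadd _) _; first by move=> i; have [[]] := hU i.
apply: lee_nneseries => i _; first by move=> _; exact: inner_ge0.
by have [] := hU i.
Qed.

HB.instance Definition _ := isOuterMeasure.Build R T outer
  outer0 outer_ge0 outer_le outer_sigma_subadd.

(** Additivity of the content on disjoint compact sets enters here: a compact
    subset K of V lying inside U leaves the open set V minus K as room for
    compact subsets that cover the rest. *)
Lemma open_caratheodory U : open U -> outer.-caratheodory U.
Proof.
move=> oU; apply: le_caratheodory_measurable => X.
apply: le_ereal_inf_tmp => _ [V [oV XV] <-].
apply: (@le_trans _ _ (inner (V `&` U) + outer (V `&` ~` U))%E).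
  rewrite -outer_open; last exact: openI.
  by apply: leeD; apply: outer_le; exact: setSI.
rewrite -leeBrDr ?outer_fin//.
apply: ge_ereal_sup => _ [K [cK KVU] <-]; rewrite leeBrDr ?outer_fin//.
have oVK : open (V `\` K).
  by apply: openI => //; exact: closed_openC (compact_closed hT cK).
apply: (@le_trans _ _ ((m K)%:E + inner (V `\` K))%E).
  rewrite leeD2l// -outer_open//; apply: outer_le => x [Vx nUx].
  by split => // /KVU [].
rewrite addeC -leeBrDr//; apply: ge_ereal_sup => _ [K' [cK' KV] <-].
rewrite leeBrDr// -EFinD -mU; first last.
- by apply/seteqP; split => // x [/KV []].
- exact: compact_mble.
- exact: compact_mble.
apply: inner_ub; first exact: compactU.
by move=> x [/KV []//|/KVU []].
Qed.

Lemma borel_caratheodory B : mble B -> outer.-caratheodory B.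
Proof.
apply: smallest_sub => [|U oU]; last exact: open_caratheodory.
split.
- exact: caratheodory_measurable_set0.
- by move=> C cC; rewrite setTD; exact: caratheodory_measurable_setC.
- by move=> F cF; exact: caratheodory_measurable_bigcup.
Qed.

Definition radonization : set (borel T) -> \bar R := outer.

Lemma radonization_sigma_additive : semi_sigma_additive radonization.
Proof.
move=> F mF tF mUF.
apply: (@caratheodory_measure_sigma_additive R T outer F) => //.
  by move=> i; exact: borel_caratheodory.
exact: borel_caratheodory.
Qed.

HB.instance Definition _ := isMeasure.Build _ (borel T) R radonization
  outer0 outer_ge0 radonization_sigma_additive.

Let mu : {measure set (borel T) -> \bar R} := radonization.

Lemma radonization_setT : mu setT = (m setT)%:E.
Proof.
apply/eqP; rewrite eq_le; apply/andP; split.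
  by rewrite [mu _]outer_open ?inner_le_content//; exact: openT.
apply/lee_addgt0Pr => e e0; have [K cK mK] := m_tight e0.
rewrite -leeBlDr// -EFinB.
apply: (@le_trans _ _ (m K)%:E); first by rewrite lee_fin.
by rewrite [mu _]outer_open; [exact: inner_ub|exact: openT].
Qed.

Let f (E : set T) : R := fine (mu E).

Let muE (E : set T) : mu E = (f E)%:E.
Proof. by rewrite fineK//; exact: outer_fin. Qed.

Let fU (B C : set T) : mble B -> mble C -> B `&` C = set0 ->
  f (B `|` C) = f B + f C.
Proof.
move=> mB mC BC; apply: EFin_inj; rewrite EFinD -!muE.
exact: (@measureU _ R (borel T) mu).
Qed.

Let f_le (B C : set T) : mble B -> mble C -> B `<=` C -> f B <= f C.
Proof. by move=> mB mC BC; rewrite -lee_fin -!muE; exact: outer_le. Qed.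

Let fsub (B C : set T) : mble B -> mble C -> f (B `|` C) <= f B + f C.
Proof.
move=> mB mC; rewrite -lee_fin EFinD -!muE.
exact: (@measureU2 _ (borel T) R mu).
Qed.

Lemma radonization_closed C : closed C -> ((m C)%:E <= mu C)%E.
Proof.
move=> cC; have oC : open (~` C) by exact: closed_openC.
have mC := borel_closed cC; have mC' := borel_open oC.
have : (mu (~` C) <= (m (~` C))%:E)%E.
  by rewrite [mu _]outer_open// inner_le_content.
have := radonization_setT; rewrite !muE !lee_fin => -[].
rewrite -(setvU C) fU ?setICl// mU ?setICl// => h1 h2; lra.
Qed.

Lemma radonization_open U : open U -> (mu U <= (m U)%:E)%E.
Proof. by move=> oU; rewrite [mu _]outer_open// inner_le_content. Qed.

(** Outer regularity holds by construction; complements inside a compact set of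
    almost full mass turn it into inner regularity. *)
Lemma radonization_radon : radon mu.
Proof.
split.
  move=> x; exists setT; first by split => //; exact: openT.
  by rewrite radonization_setT ltry.
move=> B mB; apply/eqP; rewrite eq_le; apply/andP; split; last first.
  apply: ge_ereal_sup => _ [K [cK KB] <-]; apply: le_measure => //.
    by rewrite inE; exact: compact_mble.
  by rewrite inE.
apply/lee_addgt0Pr => e e0; have e2 : 0 < e / 2 by rewrite divr_gt0.
have [K cK mK] := m_tight e2.
have [U [oU BU] hU] := outer_approx (~` B) e2.
pose C := K `\` U.
have cC : compact C.
  apply: (@subclosed_compact _ C K) => //; last exact: subDsetl.
  by apply: closedI; [exact: compact_closed|exact: open_closedC].
have CB : C `<=` B by move=> x [Kx nU]; apply: contrapT => /BU.
have mC := compact_mble cC; have mK' := compact_mble cK.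
have mU' := borel_open oU.
have mnK := borel_open (closed_openC (compact_closed hT cK)).
have mUB : mble (U `&` B) by exact: (@measurableI _ (borel T)).
have mnB : mble (~` B) by exact: (@measurableC _ (borel T)).
have nK : f (~` K) <= e / 2.
  have := radonization_closed (compact_closed hT cK).
  have := radonization_setT; rewrite !muE lee_fin -(setvU K) fU ?setICl// setvU.
  by move=> [h h']; lra.
have UB : f (U `&` B) <= e / 2.
  have : f U <= f (~` B) + e / 2.
    rewrite -lee_fin EFinD -!muE.
    by move: hU; rewrite -outer_open.
  have EU : U = (~` B) `|` (U `&` B).
    apply/seteqP; split => x; last by move=> [/BU|[]].
    by move=> Ux; have [Bx|nB] := pselect (B x); [right|left].
  by rewrite {1}EU fU ?lerD2l// setICA setICl setI0.
apply: (@le_trans _ _ (mu C + e%:E)%E); last first.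
  by rewrite leeD2r//; apply: ereal_sup_ubound; exists C.
rewrite !muE -EFinD lee_fin.
have mKU : mble (~` K `|` U `&` B) by exact: (@measurableU _ (borel T)).
apply: (@le_trans _ _ (f (C `|` (~` K `|` U `&` B)))).
  apply: f_le => //; first exact: (@measurableU _ (borel T)).
  move=> x Bx; have [Kx|nKx] := pselect (K x); last by right; left.
  by have [Ux|nU] := pselect (U x); [right; right|left].
apply: le_trans (fsub _ _) _ => //; rewrite lerD2l.
apply: le_trans (fsub _ _) _ => //; lra.
Qed.

(** Closed sets gain and open sets lose mass, as in the portmanteau theorem. *)
Theorem content_to_radon : exists mu : {measure set (borel T) -> \bar R},
  [/\ radon mu, mu setT = (m setT)%:E,
      forall C, closed C -> ((m C)%:E <= mu C)%E
    & forall U, open U -> (mu U <= (m U)%:E)%E].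
Proof.
by exists mu; split; [exact: radonization_radon|exact: radonization_setT|
  exact: radonization_closed|exact: radonization_open].
Qed.

End ContentToRadon.

(** Inner regularity extends continuity from below to uncountable unions of
    open sets: only the compact subsets of the union matter, and each of them
    meets finitely many of the open sets. *)
Lemma radon_bigcup_open (R : realType) (T : ptopologicalType)
    (mu : {measure set (borel T) -> \bar R}) (I : choiceType) (D : set I)
    (U : I -> set T) (c : \bar R) :
  hausdorff_space T -> radon mu -> (forall i, D i -> open (U i)) ->
  (forall E : {fset I}, {subset E <= D} ->
     (mu (\bigcup_(i in [set` E]) U i) <= c)%E) ->
  (mu (\bigcup_(i in D) U i) <= c)%E.
Proof.
move=> hT [_ inr] oU hE.
have oDU : open (\bigcup_(i in D) U i) by exact: bigcup_open.
rewrite inr; last exact: borel_open.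
apply: ge_ereal_sup => _ [K [cK KU] <-].
have := cK; rewrite compact_cover => /(_ I D U oU KU) [E ED KE].
apply: le_trans (hE E ED); apply: le_measure => //; rewrite inE.
  exact: borel_compact.
by apply: borel_open; apply: bigcup_open => i /ED /set_mem; exact: oU.
Qed.

Lemma ultra_limit (R : realType) (I : Type) (F : set_system I) (f : I -> R) a b :
  UltraFilter F -> (\forall i \near F, a <= f i <= b) -> cvg (f i @[i --> F]).
Proof.
move=> FF fab.
have [p [_ clp]] : `[a, b] `&` cluster (f i @[i --> F]) !=set0.
  apply: segment_compact; apply: filterS fab => i.
  by rewrite /= in_itv.
apply/cvg_ex; exists p => N Np.
have [//|FN] := in_ultra_setVsetC (f @^-1` N) FF.
by have [x [/=]] := clp (~` N) N FN Np.
Qed.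

(** The limit of the measures along an ultrafilter is finitely additive, and
    tight because the family is; its Radon measure keeps the upper bounds on
    finite sums of measures of open sets. *)
Theorem ultra_radon (R : realType) (T : ptopologicalType) (I : Type)
    (F : set_system I) (mI : I -> {measure set (borel T) -> \bar R}) :
  UltraFilter F -> hausdorff_space T -> regular_space T ->
  (\forall i \near F, mI i setT = 1%E) ->
  (forall e : R, 0 < e ->
    exists2 K, compact K & \forall i \near F, (mI i (~` K) <= e%:E)%E) ->
  exists mu : {measure set (borel T) -> \bar R},
    [/\ radon mu, mu setT = 1%E &
      forall n (O : nat -> set T) (c : R), (forall k, open (O k)) ->
        (\forall i \near F, \sum_(k < n) mI i (O k) <= c%:E)%E ->
        (\sum_(k < n) mu (O k) <= c%:E)%E].
Proof.
move=> FF hT rT m1 tight.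
have mfin i (B : set (borel T)) : mI i setT = 1%E -> measurable B ->
    mI i B = (fine (mI i B))%:E /\ 0 <= fine (mI i B) <= 1.
  move=> mi1 mB; have le1 : (mI i B <= 1)%E.
    by rewrite -mi1; apply: le_measure; rewrite ?inE.
  have fB : mI i B = (fine (mI i B))%:E.
    rewrite fineK// ge0_fin_numE//; exact: le_lt_trans le1 (ltry _).
  by split => //; rewrite -!lee_fin -fB le1 andbT.
pose m (B : set T) : R := lim (fine (mI i B) @[i --> F]).
have cm (B : set (borel T)) : measurable B ->
    cvg ((fun i => fine (mI i B)) i @[i --> F]).
  move=> mB; apply: (ultra_limit FF (a := 0) (b := 1)).
  by apply: filterS m1 => i mi; have [] := mfin i B mi mB.
have mT : m setT = 1.
  apply/cvg_lim => //; apply: cvg_near_cst.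
  by apply: filterS m1 => i /= ->.
have m_ge0 (B : set (borel T)) : measurable B -> 0 <= m B.
  move=> mB; apply: limr_ge; first exact: cm.
  by apply: filterS m1 => i mi; have [_ /andP[]] := mfin i B mi mB.
have mU (B C : set (borel T)) : measurable B -> measurable C ->
     B `&` C = set0 -> m (B `|` C) = m B + m C.
  move=> mB mC BC; apply: cvg_lim => //.
  suff : fine (mI i B) + fine (mI i C) @[i --> F] --> m B + m C.
    apply: cvg_trans; apply: near_eq_cvg; apply: filterS m1 => i mi /=.
    have [hB _] := mfin i B mi mB; have [hC _] := mfin i C mi mC.
    have [hBC _] := mfin i _ mi (measurableU _ _ mB mC).
    by apply: EFin_inj; rewrite EFinD -hB -hC -hBC measureU.
  by apply: cvgD; exact: cm.
have m_tight (e : R) : 0 < e -> exists2 K, compact K & m setT - e <= m K.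
  move=> /tight[K cK hK]; exists K => //.
  have mK := borel_compact hT cK; have mK' := measurableC mK.
  have := mU K (~` K) mK mK' (setICr _); rewrite setUv mT.
  suff : m (~` K) <= e by move=> ? ?; lra.
  apply: limr_le; first exact: cm.
  apply: filterS2 m1 hK => i mi.
  by have [-> _] := mfin i _ mi mK'; rewrite lee_fin.
have [mu [rmu mu1 _ muO]] := content_to_radon hT rT m_ge0 mU m_tight.
exists mu; split => //; first by rewrite mu1 mT.
move=> n O c oO hO.
have mO k := borel_open (oO k).
apply: (@le_trans _ _ (\sum_(k < n) m (O k))%:E).
  by rewrite -sumEFin; apply: lee_sum => k _; exact: muO.
rewrite lee_fin.
have cs : \sum_(k < n) fine (mI i (O k)) @[i --> F] --> \sum_(k < n) m (O k).
  elim: n {hO} => [|n IHn].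
    by under eq_fun do rewrite big_ord0; rewrite big_ord0; exact: cvg_cst.
  under eq_fun do rewrite big_ord_recr/=; rewrite big_ord_recr/=.
  by apply: cvgD => //; exact: cm.
apply: (cvgr_to_le cs); apply: filterS2 m1 hO => i mi.
rewrite -lee_fin -sumEFin; apply: le_trans; apply: lee_sum => k _.
by have [<-] := mfin i _ mi (mO k).
Qed.

(** * Random signs *)

Section SignSums.
Variable U : zmodType.

Fixpoint signsums (E : seq U) : seq U :=
  if E is e :: E' then
    [seq v + e | v <- signsums E'] ++ [seq v - e | v <- signsums E']
  else [:: 0].

Lemma size_signsums E : size (signsums E) = (2 ^ size E)%N.
Proof.
by elim: E => //= e E IH; rewrite size_cat !size_map IH expnS mul2n -addnn.
Qed.

Lemma big_signsums_cons (W : nmodType) (f : U -> W) e E :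
  \sum_(v <- signsums (e :: E)) f v =
  \sum_(v <- signsums E) (f (v + e) + f (v - e)).
Proof. by rewrite /= big_cat !big_map big_split. Qed.

End SignSums.

Lemma map_signsums (U W : zmodType) (f : {additive U -> W}) E :
  [seq f v | v <- signsums E] = signsums [seq f e | e <- E].
Proof.
elim: E => [|e E IH] /=; first by rewrite raddf0.
rewrite map_cat -!map_comp -IH -!map_comp; congr (_ ++ _); apply: eq_map => v /=.
  by rewrite raddfD.
by rewrite raddfB.
Qed.

Section SignMoments.
Variable R : realType.
Implicit Types x : seq R.

Lemma signsums_const (U : zmodType) (E : seq U) (c : R) :
  \sum_(v <- signsums E) c = 2 ^+ size E * c.
Proof.
by rewrite big_const_seq count_predT iter_addr_0 size_signsums -[LHS]mulr_natl -natrX.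
Qed.

Lemma signsums_sqr x :
  \sum_(v <- signsums x) v ^+ 2 = 2 ^+ size x * \sum_(e <- x) e ^+ 2.
Proof.
elim: x => [|e x IH]; first by rewrite big_seq1 big_nil expr0n/= mulr0.
rewrite big_signsums_cons big_cons /= exprS.
rewrite (eq_bigr (fun v => 2 * v ^+ 2 + 2 * e ^+ 2)); last by move=> v _; lra.
rewrite big_split/= -mulr_sumr IH signsums_const.
lra.
Qed.

Lemma signsums_pow4 x :
  \sum_(v <- signsums x) v ^+ 4 <=
  3 * (2 ^+ size x * (\sum_(e <- x) e ^+ 2) ^+ 2).
Proof.
elim: x => [|e x IH]; first by rewrite big_seq1 big_nil !expr0n/= !mulr0.
rewrite big_signsums_cons big_cons /= exprS.
rewrite (eq_bigr (fun v => 2 * v ^+ 4 + (12 * e ^+ 2) * v ^+ 2 + 2 * e ^+ 4));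
  last by move=> v _; lra.
rewrite !big_split/= -!mulr_sumr signsums_sqr signsums_const.
have : 0 <= (2 : R) ^+ size x by rewrite exprn_ge0.
move: IH; set N := 2 ^+ _; set s := \sum_(e <- x) _; set t := \sum_(v <- _) _.
move=> h N0.
have : 0 <= N * e ^+ 4 by rewrite mulr_ge0// exprn_even_ge0.
lra.
Qed.

(** A quadratic minorant of the indicator, evaluated with the second and
    fourth moments (Paley and Zygmund's argument). *)
Lemma signsums_large x (r : R) : 0 < r -> r ^+ 2 <= \sum_(e <- x) e ^+ 2 ->
  2 ^+ size x / 5 <= \sum_(v <- signsums x) ((r / 2 <= `|v|)%R%:R : R).
Proof.
move=> r0; set s := \sum_(e <- x) _ => rs.
have s0 : 0 < s by apply: lt_le_trans rs; rewrite exprn_gt0.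
(* 2 z - z ^ 2 is at most 1, and negative as soon as v ^ 2 < s / 4, that is
   when z < 0; its mean over the signs is at least 1 / 5. *)
pose z (v : R) := (v ^+ 2 / s - 1 / 4) / 4.
apply: (@le_trans _ _ (\sum_(v <- signsums x) (2 * z v - (z v) ^+ 2))).
  rewrite (eq_bigr (fun v => - (s ^- 2 / 16) * v ^+ 4 +
      (s^-1 * (17 / 32)) * v ^+ 2 + (- (33 / 256)))); last first.
    by move=> v _; rewrite /z -exprVn; lra.
  rewrite !big_split/= -!mulr_sumr signsums_sqr signsums_const -/s.
  have := signsums_pow4 x; rewrite -/s.
  have : 0 <= (2 : R) ^+ size x by rewrite exprn_ge0.
  set N := 2 ^+ _; set t := \sum_(v <- _) _ => N0 h.
  have h2 : s ^- 2 * t <= 3 * N.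
    rewrite mulrC ler_pdivrMr ?exprn_gt0//; move: h; lra.
  have h3 : s^-1 * (N * s) = N by rewrite mulrC mulfK ?gt_eqF.
  have -> : s^-1 * (17 / 32) * (N * s) = 17 / 32 * (s^-1 * (N * s)) by lra.
  rewrite h3; lra.
apply: ler_sum => v _; have [rv|vr] := lerP (r / 2) `|v|.
  by have := sqr_ge0 (1 - z v); rewrite mulr1n; lra.
have z0 : z v <= 0.
  rewrite /z mulr_le0_ge0// subr_le0 ler_pdivrMr//.
  have : `|v| ^+ 2 <= (r / 2) ^+ 2.
    by rewrite ler_sqr ?nnegrE// ?ltW// divr_gt0.
  rewrite -normrX ger0_norm ?sqr_ge0//; lra.
by have := sqr_ge0 (z v); rewrite mulr0n; lra.
Qed.

End SignMoments.

Section RandomSigns.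
Context d (Y : measurableType d) (R : realType).
Variables (P : {measure set Y -> \bar R}) (U : lmodType R) (G : set U).
Variables (X : Y -> {scalar U}) (b : U -> R).
Hypotheses (P1 : P setT = 1%E)
  (G0 : G 0) (GD : forall u v, G u -> G v -> G (u + v))
  (GZ : forall (a : R) u, G u -> G (a *: u))
  (mX : forall u, measurable_fun setT (X ^~ u))
  (b_ge0 : forall u, 0 <= b u)
  (bZ : forall a u, b (a *: u) = a ^+ 2 * b u)
  (b_parallelogram : forall u v, b (u + v) + b (u - v) = 2 * b u + 2 * b v).

Lemma signsums_closed (E : seq U) : (forall e, e \in E -> G e) ->
  forall v, v \in signsums E -> G v.
Proof.
elim: E => [|e E IH] GE v; first by rewrite inE => /eqP ->.
have Ge : G e by apply: GE; rewrite mem_head.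
have {}IH : forall w, w \in signsums E -> G w.
  by apply: IH => u uE; apply: GE; rewrite inE uE orbT.
rewrite /= mem_cat => /orP[] /mapP[w /IH Gw ->]; apply: GD => //.
by rewrite -scaleN1r; exact: GZ.
Qed.

Lemma signsums_quadratic (E : seq U) :
  \sum_(v <- signsums E) b v = 2 ^+ size E * \sum_(e <- E) b e.
Proof.
elim: E => [|e E IH].
  by rewrite big_seq1 big_nil mulr0 -[X in b X](scale0r 0) bZ expr0n/= mul0r.
rewrite big_signsums_cons big_cons /= exprS.
rewrite (eq_bigr (fun v => 2 * b v + 2 * b e)); last by move=> v _.
rewrite big_split/= -mulr_sumr IH signsums_const; lra.
Qed.

Let mnorm (c : R) u : measurable [set y | c <= `|X y u|].
Proof.
rewrite -[X in measurable X]setTI.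
apply: (@measurable_fun_le _ _ _ setT (cst c) (fun y => `|X y u|)) => //.
exact: measurableT_comp.
Qed.

(** Concentration is only assumed for vectors u with b u <= dl ^ 2; when
    (2 / r) u is outside that ball the right-hand side exceeds 1. *)
Lemma norm_ge_bound (e dl r : R) u : 0 <= e -> 0 < dl -> 0 < r -> G u ->
  (forall v, G v -> b v <= dl ^+ 2 -> (P [set y | (1 <= `|X y v|)%R] <= e%:E)%E) ->
  (P [set y | (r / 2 <= `|X y u|)%R] <= (e + 4 * b u / (r ^+ 2 * dl ^+ 2))%:E)%E.
Proof.
move=> e0 dl0 r0 Gu hP.
have r2 : 0 < 2 / r by rewrite divr_gt0.
have rd : 0 < r ^+ 2 * dl ^+ 2 by rewrite mulr_gt0// exprn_gt0.
have bv : b ((2 / r) *: u) = 4 * b u / r ^+ 2.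
  by rewrite bZ expr_div_n -natrX mulrAC.
have [bs|bl] := lerP (b ((2 / r) *: u)) (dl ^+ 2).
  rewrite (_ : [set y | _] = [set y | (1 <= `|X y ((2 / r) *: u)|)%R]).
    apply: le_trans (hP _ (GZ _ Gu) bs) _.
    by rewrite lee_fin lerDl; apply: divr_ge0; [exact: mulr_ge0|exact: ltW].
  apply/seteqP; split => y /=; rewrite linearZ/= normrM (gtr0_norm r2).
    by rewrite -ler_pdivrMl// invf_div mulr1.
  by rewrite -ler_pdivrMl// invf_div mulr1.
apply: (@le_trans _ _ 1%E).
  by rewrite -P1; apply: le_measure; rewrite ?inE//; exact: mnorm.
rewrite lee_fin; apply: (@le_trans _ _ (4 * b u / (r ^+ 2 * dl ^+ 2))).
  by rewrite invfM mulrA -bv ler_pdivlMr ?exprn_gt0// mul1r ltW.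
by rewrite lerDr.
Qed.

(** If the sum of squares is large then, for a fixed proportion of the signs,
    the signed sum is large as well; averaging over the signs turns the trace
    of b over E into an upper bound. *)
Lemma sum_sqr_bound (E : seq U) (e dl r : R) : 0 <= e -> 0 < dl -> 0 < r ->
  (forall u, u \in E -> G u) ->
  (forall v, G v -> b v <= dl ^+ 2 -> (P [set y | (1 <= `|X y v|)%R] <= e%:E)%E) ->
  (P [set y | (r ^+ 2 <= \sum_(u <- E) (X y u) ^+ 2)%R] <=
   (5 * (e + 4 * (\sum_(u <- E) b u) / (r ^+ 2 * dl ^+ 2)))%:E)%E.
Proof.
move=> e0 dl0 r0 GE hP; set A := [set y | _].
have mA : measurable A.
  rewrite -[X in measurable X]setTI.
  apply: (@measurable_fun_le _ _ _ setT (cst (r ^+ 2))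
    (fun y => \sum_(u <- E) (X y u) ^+ 2)) => //.
  by apply: measurable_sum => u; exact: measurable_funM.
pose N : R := 2 ^+ size E.
have N0 : 0 < N by rewrite exprn_gt0.
pose B v := [set y | r / 2 <= `|X y v|].
have mB D v : measurable_fun D (fun y => (\1_(B v) y)%:E : \bar R).
  by apply/measurable_EFinP; apply: measurable_indic; exact: mnorm.
have h1 : ((N / 5)%:E * P A <= \sum_(v <- signsums E) P (B v))%E.
  rewrite -integral_cst//.
  apply: (@le_trans _ _ (\int[P]_(y in A) \sum_(v <- signsums E) (\1_(B v) y)%:E)%E).
    apply: ge0_le_integral => //.
    - by move=> y _; rewrite lee_fin divr_ge0 ?ltW.
    - by apply: emeasurable_sum => v; exact: mB.
    - move=> y /= Ay; rewrite sumEFin lee_fin.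
      have := @signsums_large R [seq X y u | u <- E] r r0.
      rewrite big_map size_map => /(_ Ay); rewrite -map_signsums big_map.
      move=> h; apply: le_trans h _; apply: ler_sum => v _.
      rewrite indicE /B; case: (boolP (r / 2 <= _)) => h.
        by rewrite mem_set.
      by rewrite memNset//; exact/negP.
  rewrite ge0_integral_sum//.
  apply: lee_sum => v _; rewrite integral_indic//; last exact: mnorm.
  apply: le_measure; rewrite ?inE//; [apply: measurableI => //|]; exact: mnorm.
have PA : P A = (fine (P A))%:E.
  rewrite fineK// ge0_fin_numE//; apply: le_lt_trans (ltry 1).
  by rewrite -P1; apply: le_measure; rewrite ?inE.
have h2 : (\sum_(v <- signsums E) P (B v) <=
    (N * (e + 4 * (\sum_(u <- E) b u) / (r ^+ 2 * dl ^+ 2)))%:E)%E.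
  apply: (@le_trans _ _ (\sum_(v <- signsums E)
      (e + 4 * b v / (r ^+ 2 * dl ^+ 2))%:E)%E).
    rewrite big_seq_cond [leRHS]big_seq_cond; apply: lee_sum => v.
    rewrite andbT => /(signsums_closed GE) Gv; exact: norm_ge_bound.
  rewrite sumEFin lee_fin big_split/= -mulr_suml -mulr_sumr signsums_quadratic.
  rewrite signsums_const -/N; lra.
have := le_trans h1 h2; rewrite PA -EFinM !lee_fin.
move: (fine _) (e + _) => x y h; rewrite -(ler_pM2l N0); lra.
Qed.

End RandomSigns.

(** * Orthonormal families of a Hilbertian seminorm *)

Lemma sum_cauchy_schwarz (R : realType) (I : Type) (s : seq I) (c x : I -> R) :
  (\sum_(i <- s) c i * x i) ^+ 2 <=
  (\sum_(i <- s) c i ^+ 2) * (\sum_(i <- s) x i ^+ 2).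
Proof.
elim: s => [|i s IH]; first by rewrite !big_nil expr0n/= mulr0.
rewrite !big_cons; move: IH.
have : 0 <= \sum_(j <- s) (c i * x j - x i * c j) ^+ 2.
  by apply: sumr_ge0 => j _; exact: sqr_ge0.
rewrite (eq_bigr (fun j => c i ^+ 2 * x j ^+ 2 + x i ^+ 2 * c j ^+ 2 -
  (2 * c i * x i) * (c j * x j))); last by move=> j _; lra.
rewrite !big_split/= sumrN -!mulr_sumr.
set C := \sum_(j <- s) c j ^+ 2; set X := \sum_(j <- s) x j ^+ 2.
set D := \sum_(j <- s) c j * x j; lra.
Qed.

Section HilbertianSeminorm.
Variables (R : realType) (U : lmodType R) (q : hilbertian_seminorm U).
Local Notation h := (hform q).

Lemma hformDl u v w : h (u + v) w = h u w + h v w.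
Proof. by rewrite linearDl. Qed.

Lemma hformZl a u v : h (a *: u) v = a * h u v.
Proof. by rewrite linearZl_LR. Qed.

Lemma hformDr u v w : h w (u + v) = h w u + h w v.
Proof. by rewrite linearD. Qed.

Lemma hformZr a u v : h v (a *: u) = a * h v u.
Proof. by rewrite linearZ. Qed.

Lemma hform_sumr (I : Type) (s : seq I) (f : I -> U) v :
  h v (\sum_(i <- s) f i) = \sum_(i <- s) h v (f i).
Proof. by rewrite linear_sum. Qed.

Lemma hform_suml (I : Type) (s : seq I) (f : I -> U) v :
  h (\sum_(i <- s) f i) v = \sum_(i <- s) h (f i) v.
Proof. by rewrite hform_sym hform_sumr; apply: eq_bigr => i _; exact: hform_sym. Qed.

Lemma hnorm_sqr v : q v ^+ 2 = h v v.
Proof. by rewrite hnormE sqr_sqrtr// hform_ge0. Qed.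

Lemma hnorm_ge0 v : 0 <= q v.
Proof. by rewrite hnormE sqrtr_ge0. Qed.

Lemma hnormZ a v : q (a *: v) = `|a| * q v.
Proof.
by rewrite !hnormE hformZl hformZr mulrA -expr2 sqrtrM ?sqr_ge0// sqrtr_sqr.
Qed.

Lemma hform_null u v : q u = 0 -> h u v = 0.
Proof.
move=> qu; have huu : h u u = 0 by rewrite -hnorm_sqr qu expr0n.
apply/eqP; apply: contraT => hn0.
have := hform_ge0 q (v + (- (h v v + 1) / (2 * h u v)) *: u).
rewrite hformDl !hformDr !hformZl !hformZr huu (hform_sym q v u).
have : (- (h v v + 1) / (2 * h u v)) * h u v = - (h v v + 1) / 2.
  by rewrite invfM mulrA divfK.
set t := _ / (_ * _) => E; lra.
Qed.

Lemma orthonormal_coef (E : seq U) (c : U -> R) w : uniq E ->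
  {in E &, forall u v, h u v = (u == v)%:R} -> w \in E ->
  h (\sum_(e <- E) c e *: e) w = c w.
Proof.
move=> uE oE wE; rewrite hform_suml (bigD1_seq w)//= hformZl oE// eqxx mulr1.
rewrite big_seq_cond big1 ?addr0// => e /andP[eE ew].
by rewrite hformZl oE// (negbTE ew) mulr0.
Qed.

Lemma orthonormal_sqr (E : seq U) (c : U -> R) : uniq E ->
  {in E &, forall u v, h u v = (u == v)%:R} ->
  q (\sum_(e <- E) c e *: e) ^+ 2 = \sum_(e <- E) c e ^+ 2.
Proof.
move=> uE oE; rewrite hnorm_sqr hform_sumr big_seq [RHS]big_seq.
by apply: eq_bigr => e eE; rewrite hformZr orthonormal_coef.
Qed.

(** Gram-Schmidt for a degenerate form: the expansion of a vector in the
    orthonormal family is only determined up to a q-null vector k. *)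
Lemma gram_schmidt (G : set U) (F : seq U) :
  (forall u v, G u -> G v -> G (u + v)) -> (forall a u, G u -> G (a *: u)) ->
  G 0 -> (forall v, v \in F -> G v) ->
  exists E : seq U, [/\ uniq E, forall e, e \in E -> G e,
    {in E &, forall u v, h u v = (u == v)%:R} &
    forall v, v \in F -> exists k, [/\ G k, q k = 0 &
      v = \sum_(e <- E) h v e *: e + k]].
Proof.
move=> GD GZ G0; elim: F => [|v F IH] GF; first by exists [::]; split.
have [u uF|E [uE GE oE FE]] := IH; first by apply: GF; rewrite inE uF orbT.
have Gv : G v by apply: GF; rewrite mem_head.
pose w := v - \sum_(e <- E) h v e *: e.
have Gw : G w.
  apply: (GD) => //; rewrite -scaleN1r; apply: (GZ).
  by rewrite big_seq; apply: (big_ind G) => // e eE; apply: GZ; exact: GE.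
have hw e : e \in E -> h w e = 0.
  move=> eE; rewrite hformDl -scaleN1r hformZl orthonormal_coef// mulN1r subrr//.
have vw : v = \sum_(e <- E) h v e *: e + w by rewrite addrC subrK.
have [qw|qw] := eqVneq (q w) 0.
  exists E; split => // u; rewrite inE => /predU1P[->|/FE//].
  by exists w.
have qw0 : 0 < q w by rewrite lt_neqAle eq_sym qw hnorm_ge0.
pose f := (q w)^-1 *: w.
have hfe e : e \in E -> h f e = 0 by move=> eE; rewrite hformZl hw// mulr0.
have hff : h f f = 1.
  by rewrite hformZl hformZr -hnorm_sqr expr2 mulKf// mulVf.
have fE : f \notin E.
  by apply/negP => /[dup] fE /hfe; rewrite hff => /eqP; rewrite oner_eq0.
exists (f :: E); split.
- by rewrite /= fE.
- by move=> e; rewrite inE => /predU1P[->|/GE//]; exact: GZ.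
- move=> a b; rewrite !inE => /predU1P[->|aE] /predU1P[->|bE].
  + by rewrite eqxx.
  + by rewrite hfe//; case: eqP fE => // ->; rewrite bE.
  + by rewrite hform_sym hfe//; case: eqP fE => // <-; rewrite aE.
  + exact: oE.
- move=> u; rewrite inE => /predU1P[->|/FE[k [Gk qk uk]]].
    exists 0; split => //; first by rewrite hnormE linear0 sqrtr0.
    rewrite addr0 big_cons addrC {1}vw; congr (_ + _).
    have hfv : h f v = q w.
      rewrite {1}vw hformDr hform_sumr big_seq big1 ?add0r; last first.
        by move=> e eE; rewrite hformZr hfe// mulr0.
      by rewrite hformZl -hnorm_sqr expr2 mulKf.
    by rewrite hform_sym hfv scalerA divff// scale1r.
  exists k; split => //; rewrite big_cons.
  suff -> : h u f = 0 by rewrite scale0r add0r.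
  rewrite uk hformDl (hform_null _ qk) addr0 hform_suml big_seq big1// => e eE.
  by rewrite hformZl (hform_sym q e) hfe// mulr0.
Qed.

Lemma orthonormal_trace_le (p : hilbertian_seminorm U) (E : seq U) (c : R) :
  uniq E -> {in E &, forall u v, h u v = (u == v)%:R} ->
  (seminorm_trace p q <= c%:E)%E -> \sum_(e <- E) p e ^+ 2 <= c.
Proof.
move=> uE oE trc; rewrite -lee_fin; apply: le_trans trc.
rewrite /seminorm_trace; case: ifPn => [_|_]; last by rewrite leey.
apply: ereal_sup_ubound; exists [fset x in E]%fset.
  by move=> u v; rewrite !inE => uE' vE; exact: oE.
congr (_%:E); apply: perm_big; apply: uniq_perm => // x.
by rewrite inE.
Qed.

End HilbertianSeminorm.

(** * Concentration on characters of a finitely generated subalgebra *)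

Lemma continuous_borel (T T' : ptopologicalType) (f : T -> T') :
  continuous f -> measurable_fun setT (f : borel T -> borel T').
Proof.
move=> cf; apply: (@measurability _ _ (borel T) (borel T') setT f open) => //.
move=> _ [U oU <-]; rewrite setTI; apply: borel_open.
by apply: open_comp => // x _; exact: cf.
Qed.

Lemma continuous_borel_real (R : realType) (T : ptopologicalType) (f : T -> R) :
  continuous f -> measurable_fun setT (f : borel T -> R).
Proof.
move=> cf.
apply: (@measurability _ _ (borel T) R setT f _ (RGenOInfty.measurableE R)).
move=> _ [_ [r ->] <-]; rewrite setTI set_itvoy; apply: borel_open.
by apply: open_comp => [x _|]; [exact: cf|exact: open_gt].
Qed.

Section Minlos.
Variables (R : realType) (A : comAlgType R) (x0 : character A)
  (V : submodClosed A) (p q : hilbertian_seminorm (subspace_of V))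
  (S : subalgClosed A).

Definition in_subalg (a : A) : subalgebra_of S := insubd 0 a.

Lemma in_subalgK a : a \in S -> val (in_subalg a) = a.
Proof. by move=> aS; rewrite insubdK. Qed.

Lemma in_subalgD a b : a \in S -> b \in S ->
  in_subalg (a + b) = in_subalg a + in_subalg b.
Proof.
move=> aS bS; apply: val_inj; rewrite in_subalgK ?rpredD//= -!/(val _).
by rewrite !in_subalgK.
Qed.

Lemma in_subalgZ c a : a \in S -> in_subalg (c *: a) = c *: in_subalg a.
Proof.
by move=> aS; apply: val_inj; rewrite in_subalgK ?rpredZ//= -!/(val _) in_subalgK.
Qed.

Local Notation T := (charspace (char_res S x0)).

Definition eval_sub (v : subspace_of V) (x : T) : R :=
  hat (char_res S x0) (in_subalg (val v)) x.

Lemma eval_sub_continuous v : continuous (eval_sub v).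
Proof. exact: hat_continuous. Qed.

Lemma eval_sub_measurable v :
  measurable_fun setT (eval_sub v : borel T -> R).
Proof. by apply: continuous_borel_real; exact: eval_sub_continuous. Qed.

Hint Resolve eval_sub_measurable : core.

Variable P : {measure set (borel T) -> \bar R}.
Hypothesis P1 : P setT = 1%E.

Definition ball_bound (e d : R) := forall (v : subspace_of V)
  (a : subalgebra_of S), val v = val a -> p v <= d ->
  (P [set x | (1 <= `|hat (char_res S x0) a x|)%R] <= e%:E)%E.

Lemma eval_sub_sum_bound (E : seq (subspace_of V)) (e d r c : R) :
  0 <= e -> 0 < d -> 0 < r -> ball_bound e d ->
  (forall v, v \in E -> val v \in S) -> \sum_(v <- E) p v ^+ 2 <= c ->
  (P [set x | (r ^+ 2 <= \sum_(v <- E) (eval_sub v x) ^+ 2)%R] <=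
    (5 * (e + 4 * c / (r ^+ 2 * d ^+ 2)))%:E)%E.
Proof.
move=> e0 d0 r0 hP ES trc.
pose U := (subspace_of V * subalgebra_of S)%type.
pose G := [set u : U | val u.1 = val u.2].
pose X (x : borel T) : {scalar U} := (x : character (subalgebra_of S)) \o snd.
pose b (u : U) := hform p u.1 u.1.
pose E' : seq U := [seq (v, in_subalg (val v)) | v <- E].
have XE x u : X x u = hat (char_res S x0) u.2 x by [].
apply: (@le_trans _ _ (5 * (e + 4 * (\sum_(u <- E') b u) / (r ^+ 2 * d ^+ 2)))%:E).
  rewrite (_ : [set x | _] = [set x | r ^+ 2 <= \sum_(u <- E') (X x u) ^+ 2]);
    last by apply/seteqP; split => x /=; rewrite big_map.
  apply: (@sum_sqr_bound _ (borel T) R P U G X b) => //.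
  - by move=> [u1 u2] [v1 v2]; rewrite /G/= => -> ->.
  - by move=> a [u1 u2]; rewrite /G/= => ->.
  - by move=> u; apply: continuous_borel_real; exact: hat_continuous.
  - by move=> u; exact: hform_ge0.
  - by move=> a u; rewrite /b/= hformZl hformZr mulrA.
  - move=> u v; rewrite /b/= -scaleN1r !hformDl !hformDr !hformZl !hformZr.
    rewrite (hform_sym p v.1); lra.
  - by move=> _ /mapP[v vE ->]; rewrite /G/= in_subalgK//; exact: ES.
  - move=> u Gu bu; rewrite (_ : [set x | _] = [set x | (1 <= `|hat (char_res S x0) u.2 x|)%R])//.
    apply: hP Gu _; rewrite -ler_sqr ?nnegrE ?hnorm_ge0 ?(ltW d0)//.
    by rewrite hnorm_sqr.
rewrite lee_fin ler_pM2l// lerD2l ler_pM2r ?invr_gt0 ?mulr_gt0 ?exprn_gt0//.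
rewrite ler_pM2l// big_map; apply: le_trans trc.
by apply: ler_sum => v _; rewrite hnorm_sqr.
Qed.

(** Every multiple of a p-null vector lies in all p-balls. *)
Lemma eval_sub_null (v : subspace_of V) :
  (forall e, 0 < e -> exists2 d, 0 < d & ball_bound e d) ->
  val v \in S -> p v = 0 -> P [set x | eval_sub v x != 0] = 0%E.
Proof.
move=> conc vS pv.
have small (n : nat) : P [set x | (1 <= `|n%:R * eval_sub v x|)%R] = 0%E.
  apply/eqP; rewrite eq_le measure_ge0 andbT; apply/lee_addgt0Pr => e e0.
  rewrite add0e; have [d d0 /(_ (n%:R *: v) (n%:R *: in_subalg (val v)))] := conc e e0.
  rewrite hnormZ pv mulr0 (ltW d0) !linearZ/= in_subalgK// => /(_ erefl isT).
  congr (_ <= _)%E; congr (P _); apply/seteqP; split => x /=;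
    by rewrite /hat linearZ.
rewrite (_ : [set x | _] = \bigcup_n [set x | 1 <= `|n%:R * eval_sub v x|]).
  have mn n : measurable ([set x | 1 <= `|n%:R * eval_sub v x|] : set (borel T)).
    rewrite -[X in measurable X]setTI.
    apply: (@measurable_fun_le _ (borel T) R setT (cst 1)) => //.
    by apply: measurableT_comp => //; exact: measurable_funM.
  apply: measure_negligible; first exact: bigcupT_measurable.
  apply: negligible_bigcup => n; apply: (negligibleP P (mn n)).2; exact: small.
apply/seteqP; split => x /= => [vx|[n _]].
  exists (Num.truncn `|eval_sub v x|^-1).+1 => //=.
  rewrite normrM normr_nat -ler_pdivrMr ?normr_gt0// mul1r.
  by apply: ltW; exact: truncnS_gt.
by apply: contraPneq => /= ->; rewrite mulr0 normr0 ler10.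
Qed.

Definition escape (r : R) (v : subspace_of V) : set T :=
  [set x | r * q v < `|eval_sub v x|].

Lemma escape_open r v : open (escape r v).
Proof.
rewrite [X in open X](_ : _ = (fun x => `|eval_sub v x|) @^-1` [set s | r * q v < s])//.
apply: open_comp; last exact: open_gt.
move=> x _; apply: continuous_comp; last exact: norm_continuous.
exact: eval_sub_continuous.
Qed.

(** Outside a null set the q-null parts of the vectors of F are annihilated, and
    by the Cauchy-Schwarz inequality the value at v is at most q v times the
    root of the sum of squares over an orthonormal family. *)
Lemma escape_fin (F : seq (subspace_of V)) (e d r c : R) :
  (forall e, 0 < e -> exists2 d, 0 < d & ball_bound e d) ->
  (forall v, q v = 0 -> p v = 0) -> (seminorm_trace p q <= c%:E)%E ->
  0 <= e -> 0 < d -> 0 < r -> ball_bound e d ->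
  (forall v, v \in F -> val v \in S) ->
  (P (\bigcup_(v in [set` F]) escape r v) <=
    (5 * (e + 4 * c / (r ^+ 2 * d ^+ 2)))%:E)%E.
Proof.
move=> conc ker trc e0 d0 r0 hP FS.
have [||||E [uE ES oE FE]] := @gram_schmidt _ _ q [set v | val v \in S] F.
- by move=> u v /=; exact: rpredD.
- by move=> a u /=; exact: rpredZ.
- exact: rpred0.
- exact: FS.
have /choice[k kE] : forall v, exists k, v \in F -> [/\ val k \in S, q k = 0 &
    v = \sum_(e <- E) hform q v e *: e + k].
  move=> v; have [vF|vF] := boolP (v \in F); last by exists 0.
  by have [k hk] := FE v vF; exists k.
pose N := \big[setU/set0]_(v <- F) [set x | eval_sub (k v) x != 0].
pose B := [set x | r ^+ 2 <= \sum_(v <- E) (eval_sub v x) ^+ 2].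
have mB : measurable (B : set (borel T)).
  rewrite -[X in measurable X]setTI.
  apply: (@measurable_fun_le _ (borel T) R setT (cst (r ^+ 2))) => //.
  by apply: measurable_sum => v; exact: measurable_funM.
have oN v : open [set x | eval_sub v x != 0].
  rewrite [X in open X](_ : _ = eval_sub v @^-1` [set s | s != 0])//.
  apply: open_comp; last exact: open_neq.
  by move=> x _; exact: eval_sub_continuous.
have mN : measurable (N : set (borel T)).
  by apply: bigsetU_measurable => v _; apply: borel_open.
have N0 : P N = 0%E.
  apply: measure_negligible => //; rewrite /N big_seq.
  apply: (big_ind (fun X : set (borel T) => P.-negligible X)).
  - exact: negligible_set0.
  - by move=> X Y; exact: negligibleU.
  - move=> v vF; apply: (negligibleP P (borel_open (oN (k v)))).2.
    by have [kS qk _] := kE v vF; apply: eval_sub_null => //; exact: ker.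
apply: (@le_trans _ _ (P (B `|` N))).
  apply: le_measure; rewrite ?inE; [|exact: measurableU|].
    by apply: borel_open; apply: bigcup_open => v _; exact: escape_open.
  move=> x [v /= vF]; rewrite /escape/= => esc.
  have [kS qk vE] := kE v vF.
  have [Bx|/negP nB] := boolP (r ^+ 2 <= \sum_(v <- E) (eval_sub v x) ^+ 2); first by left.
  right; rewrite /N -bigcup_seq; exists v => //=; apply/eqP => kx.
  have ev : eval_sub v x = \sum_(e <- E) hform q v e * eval_sub e x.
    rewrite -[RHS]addr0 -[X in _ = _ + X]kx /eval_sub.
    suff -> : in_subalg (val v) =
        \sum_(e <- E) hform q v e *: in_subalg (val e) + in_subalg (val (k v)).
      rewrite /hat raddfD raddf_sum; congr (_ + _).
      by apply: eq_bigr => i _; exact: linearZ.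
    have valE : val v = \sum_(e <- E) hform q v e *: val e + val (k v).
      by rewrite [in LHS]vE raddfD raddf_sum; congr (_ + _).
    rewrite valE in_subalgD//; last first.
      by rewrite big_seq; apply: rpred_sum => i iE; exact/rpredZ/ES.
    congr (_ + _); rewrite big_seq [RHS]big_seq.
    have [_ ->] : \sum_(i <- E | i \in E) hform q v i *: val i \in S /\
        in_subalg (\sum_(i <- E | i \in E) hform q v i *: val i) =
        \sum_(i <- E | i \in E) hform q v i *: in_subalg (val i) => //.
    apply: (big_ind2 (fun a b => a \in S /\ in_subalg a = b)).
    - split; first exact: rpred0.
      by apply: val_inj; rewrite in_subalgK// rpred0.
    - by move=> a _ a' _ [aS <-] [a'S <-]; rewrite in_subalgD// rpredD.
    - by move=> i /ES iS; rewrite in_subalgZ// rpredZ.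
  have qv : q v ^+ 2 = \sum_(e <- E) (hform q v e) ^+ 2.
    rewrite -(orthonormal_sqr (q := q) _ uE oE) !hnorm_sqr.
    rewrite {1 2}vE hformDl !hformDr (hform_null _ qk).
    by rewrite (hform_sym q _ (k v)) !(hform_null _ qk) !addr0.
  have := sum_cauchy_schwarz E (fun e => hform q v e) (fun e => eval_sub e x).
  rewrite -ev -qv; move/negP: nB; rewrite -ltNge => lt.
  have : (r * q v) ^+ 2 < `|eval_sub v x| ^+ 2.
    by rewrite ltr_pXn2r// nnegrE// mulr_ge0 ?hnorm_ge0// ltW.
  rewrite -normrX ger0_norm ?sqr_ge0// => h1 h2.
  have := lt_le_trans h1 h2; rewrite exprMn mulrC ltNge ler_wpM2l ?sqr_ge0//.
  exact: ltW.
have := @measureU2 _ (borel T) R P B N mB mN.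
move=> /le_trans; apply; rewrite [X in (_ + X)%E]N0 adde0.
apply: eval_sub_sum_bound => //.
by have := @orthonormal_trace_le _ _ q p E c uE oE trc.
Qed.

(** V may meet S in an infinite-dimensional space, so that uncountably many v
    matter; inner regularity reduces them to finitely many. *)
Lemma escape_bound (e d r c : R) :
  radon P ->
  (forall e, 0 < e -> exists2 d, 0 < d & ball_bound e d) ->
  (forall v, q v = 0 -> p v = 0) -> (seminorm_trace p q <= c%:E)%E ->
  0 <= e -> 0 < d -> 0 < r -> ball_bound e d ->
  (P (\bigcup_(v in [set v | val v \in S]) escape r v) <=
    (5 * (e + 4 * c / (r ^+ 2 * d ^+ 2)))%:E)%E.
Proof.
move=> rP conc ker trc e0 d0 r0 hP.
apply: radon_bigcup_open => //; first exact: charspace_hausdorff.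
  by move=> v _; exact: escape_open.
move=> F FS; apply: escape_fin => // v /FS.
by rewrite inE.
Qed.

End Minlos.

(** * Spaces of real functions and of characters as initial topologies *)

Lemma cvg_initial (S : choiceType) (T : topologicalType) (f : S -> T)
    (F : set_system S) (s : S) :
  Filter F -> f @ F --> f s -> F --> (s : initial_topology f).
Proof.
move=> FF cf B [_ [[C oC <-] Cs] CB].
have : (f @ F) C by apply: cf; apply: open_nbhs_nbhs.
by move=> FC; exact: filterS CB FC.
Qed.

Lemma cvg_charspace (R : realType) (A : comAlgType R) (x0 : character A)
    (F : set_system (charspace x0)) (x : charspace x0) : Filter F ->
  (forall a, hat x0 a @ F --> hat x0 a x) -> F --> x.
Proof. move=> FF h; apply/cvg_sup => a.
exact: (@cvg_initial (charspace x0) R (hat x0 a) F x FF (h a)). Qed.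

Definition realfun (I : Type) (R : realType) := I -> R.

HB.instance Definition _ (I : Type) (R : realType) :=
  Uniform.copy (realfun I R) {ptws I -> R}.
HB.instance Definition _ (I : Type) (R : realType) :=
  isPointed.Build (realfun I R) (fun=> 0).

Section RealFun.
Variables (R : realType) (I : eqType).

Lemma realfun_hausdorff : hausdorff_space (realfun I R).
Proof. by apply: (@hausdorff_product I (fun=> R)) => _; exact: Rhausdorff. Qed.

Lemma realfun_eval_continuous (i : I) : continuous (fun f : realfun I R => f i).
Proof. exact: (@proj_continuous I (fun=> R)). Qed.

Lemma cvg_realfun (F : set_system (realfun I R)) (f : realfun I R) : Filter F ->
  (forall i, (fun g => g i) @ F --> f i) -> F --> f.
Proof. move=> FF h; apply/cvg_sup => i.
exact: (@cvg_initial (realfun I R) R (fun g => g i) F f FF (h i)). Qed.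

Lemma realfun_box_compact (M : I -> R) :
  compact [set f : realfun I R | forall i, `|f i| <= M i].
Proof.
have := @tychonoff I (fun=> R) (fun i => `[- M i, M i]%classic).
move=> /(_ (fun i => @segment_compact R _ _)).
by under [X in compact X -> _]eq_set do under eq_forall do
  rewrite /= in_itv/= -ler_norml.
Qed.

End RealFun.

Lemma radon_bigcup_null (R : realType) (T : ptopologicalType)
    (mu : {measure set (borel T) -> \bar R}) (I : choiceType)
    (U : I -> set T) :
  hausdorff_space T -> radon mu -> (forall i, open (U i)) ->
  (forall i, mu (U i) = 0%E) -> mu (\bigcup_i U i) = 0%E.
Proof.
move=> hT rmu oU U0; apply/eqP; rewrite -measure_le0.
apply: radon_bigcup_open => // E _; rewrite measure_le0; apply/eqP.
apply: measure_negligible.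
  by apply: borel_open; apply: bigcup_open => i _; exact: oU.
rewrite bigcup_fset; apply: (big_ind (fun X : set (borel T) => mu.-negligible X)).
- exact: negligible_set0.
- by move=> X Y; exact: negligibleU.
- by move=> i _; exact: (negligibleP mu (borel_open (oU i))).2 (U0 i).
Qed.

Lemma within_closed_borel (T T' : ptopologicalType) (H : set T) (g : T -> T')
    (y : T') :
  closed H -> {within H, continuous g} -> (forall x, ~ H x -> g x = y) ->
  measurable_fun setT (g : borel T -> borel T').
Proof.
move=> cH /continuousP cg gH.
apply: (@measurability _ _ (borel T) (borel T') setT g open) => //.
move=> _ [U oU <-]; rewrite setTI.
have [W oW WH] := (open_subspaceP _ _).1 (cg U oU).
have mWH : measurable (W `&` H : set (borel T)).
  by apply: (@measurableI _ (borel T)); [exact: borel_open|exact: borel_closed].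
have mHC : measurable (~` H : set (borel T)).
  by apply: borel_open; exact: closed_openC.
have [Uy|nUy] := pselect (U y).
  rewrite (_ : g @^-1` U = (W `&` H) `|` ~` H).
    exact: (@measurableU _ (borel T)).
  rewrite WH; apply/seteqP; split => x /=.
    by move=> Ux; have [Hx|nHx] := pselect (H x); [left|right].
  by move=> [[]//|nHx]; rewrite gH.
rewrite (_ : g @^-1` U = W `&` H)// WH; apply/seteqP; split => x /= => [Ux|[]//].
by split => //; apply: contrapT => nHx; apply: nUy; rewrite -(gH x).
Qed.

(** A compact subset of the preimage is first cut down to H, where g is
    continuous; its image is then compact and loses no mass. *)
Lemma radon_image (R : realType) (T T' : ptopologicalType)
    (mu : {measure set (borel T) -> \bar R})
    (nu : {measure set (borel T') -> \bar R}) (H : set T) (g : T -> T') :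
  hausdorff_space T -> hausdorff_space T' -> closed H -> mu (~` H) = 0%E ->
  {within H, continuous g} -> measurable_fun setT (g : borel T -> borel T') ->
  radon mu -> (mu setT < +oo)%E ->
  (forall B : set (borel T'), measurable B -> nu B = mu (g @^-1` B)) ->
  radon nu.
Proof.
move=> hT hT' cH H0 cg mg [_ inr] fin nuE; split.
  move=> x; exists setT; first by split => //; exact: openT.
  by rewrite nuE// preimage_setT.
move=> B mB; apply/eqP; rewrite eq_le; apply/andP; split; last first.
  apply: ge_ereal_sup => _ [K [cK KB] <-]; apply: le_measure => //.
    by rewrite inE; exact: borel_compact.
  by rewrite inE.
have mgB : measurable (g @^-1` B : set (borel T)).
  by rewrite -[X in measurable X]setTI; exact: mg.
rewrite nuE// inr//; apply: ge_ereal_sup => _ [K [cK KB] <-].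
have cKH : compact (K `&` H).
  apply: (@subclosed_compact _ _ K) => //; apply: closedI => //.
  exact: compact_closed.
have cgK : compact (g @` (K `&` H)).
  apply: continuous_compact => //; apply: continuous_subspaceW cg => //.
have mgK : measurable (g @` (K `&` H) : set (borel T')) by exact: borel_compact.
apply: (@le_trans _ _ (nu (g @` (K `&` H)))); last first.
  apply: ereal_sup_ubound; exists (g @` (K `&` H)) => //; split => //.
  by move=> _ [x [Kx _] <-]; exact: KB.
rewrite nuE//.
have mC : measurable (g @^-1` (g @` (K `&` H)) : set (borel T)).
  by rewrite -[X in measurable X]setTI; exact: mg.
have mHC : measurable (~` H : set (borel T)).
  by apply: borel_open; exact: closed_openC.
have mK := borel_compact hT cK.
apply: (@le_trans _ _ (mu (g @^-1` (g @` (K `&` H)) `|` ~` H))).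
  apply: le_measure; rewrite ?inE//; first exact: (@measurableU _ (borel T)).
  move=> x Kx; have [Hx|nHx] := pselect (H x); last by right.
  by left; exists x.
have := @measureU2 _ (borel T) R mu _ _ mC mHC.
by move=> /le_trans; apply; rewrite [X in (_ + X)%E]H0 adde0.
Qed.

(** * Finitely generated subalgebras *)

Section Span.
Variables (R : realType) (A : lmodType R) (s : seq A).

Definition span_pred : {pred A} :=
  [in [set w | exists c : 'I_(size s) -> R, w = \sum_(i < size s) c i *: s`_i]].

Lemma span_submod_closed : submod_closed span_pred.
Proof.
split.
  by apply/mem_set; exists (fun=> 0); rewrite big1// => i _; rewrite scale0r.
move=> a u v /set_mem[c ->] /set_mem[d ->]; apply/mem_set.
exists (fun i => a * c i + d i); rewrite scaler_sumr -big_split/=.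
by apply: eq_bigr => i _; rewrite scalerDl scalerA.
Qed.

HB.instance Definition _ :=
  GRing.isSubmodClosed.Build R A span_pred span_submod_closed.

Definition lin_span : submodClosed A := span_pred.

Lemma mem_lin_span : {subset s <= lin_span}.
Proof.
move=> a /(nthP 0)[i si <-]; apply/mem_set.
exists (fun j => (j == Ordinal si)%:R).
rewrite (bigD1 (Ordinal si))//= eqxx scale1r big1 ?addr0// => j /negbTE ->.
by rewrite scale0r.
Qed.

Lemma lin_span_finite_dim : finite_dim lin_span.
Proof. by exists s; [exact: mem_lin_span|move=> w /set_mem]. Qed.

Lemma lin_span_sub (V : submodClosed A) : {subset s <= V} ->
  {subset lin_span <= V}.
Proof.
move=> sV w /set_mem[c ->]; apply: rpred_sum => i _; apply: rpredZ.
by apply: sV; exact: mem_nth.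
Qed.

End Span.

Lemma gen_subalg_ind (R : realType) (A : comAlgType R) (G : set A)
    (P : A -> Prop) :
  (forall g, G g -> P g) -> P 1 ->
  (forall c u v, P u -> P v -> P (c *: u + v)) ->
  (forall u v, P u -> P v -> P (u * v)) ->
  forall a, a \in gen_subalg G -> P a.
Proof.
move=> PG P1 PZ PM a /set_mem/(_ [set a | P a]); apply; split => //.
split => [|c u v|u v]; rewrite ?inE//; first exact: PZ.
exact: PM.
Qed.

Lemma fin_gen_subalgs_cofinal (R : realType) (A : comAlgType R)
    (V : submodClosed A) (s : seq A) : {subset s <= V} ->
  exists2 S, fin_gen_subalgs V S & {subset s <= S}.
Proof.
move=> sV; exists (gen_subalg [set` lin_span s]).
  exists (lin_span s) => //; split; first exact: lin_span_sub.
  exact: lin_span_finite_dim.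
by move=> a /mem_lin_span aW; apply/mem_set => M [_]; exact.
Qed.

Section Hat.
Variables (R : realType) (A : comAlgType R) (x0 : character A).
Implicit Types (a b : A) (x : charspace x0).

Lemma hatD a b x : hat x0 (a + b) x = hat x0 a x + hat x0 b x.
Proof. exact: raddfD. Qed.

Lemma hatZ c a x : hat x0 (c *: a) x = c * hat x0 a x.
Proof. exact: linearZ. Qed.

Lemma hatM a b x : hat x0 (a * b) x = hat x0 a x * hat x0 b x.
Proof. exact: rmorphM. Qed.

Lemma hat1 x : hat x0 1 x = 1.
Proof. exact: rmorph1. Qed.

End Hat.

Section CharacterBound.
Variables (R : realType) (A : comAlgType R) (x0 : character A)
  (V : submodClosed A) (q : hilbertian_seminorm (subspace_of V)).
Local Notation X S := (charspace (char_res S x0)).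

Definition bounded_by (r : R) (S : subalgClosed A) (x : X S) :=
  forall v : subspace_of V, val v \in S -> `|eval_sub v x| <= r * q v.

(** The list F of elements of V occurring in some polynomial expression of a
    is fixed before S: a bound read off from an expression valid only in S
    would depend on S. *)
Lemma char_bound (a : A) : generated_by [set` V] ->
  exists F : seq A, [/\ {subset F <= V},
    forall S : subalgClosed A, {subset F <= S} -> a \in S &
    forall r : R, exists M : R, forall (S : subalgClosed A) (x : X S),
      {subset F <= S} -> bounded_by r x ->
      `|hat (char_res S x0) (in_subalg S a) x| <= M].
Proof.
move=> [G GV genG]; move: (genG a); move: a.
apply: gen_subalg_ind => [g /GV gV||c|].
- exists [:: g]; split.
  + by move=> _ /[!inE] /eqP ->.
  + by move=> S; apply; rewrite inE.
  + move=> r; exists (r * q (SubspaceOf gV)) => S x gS /(_ (SubspaceOf gV)).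
    by apply; apply: gS; rewrite inE.
- exists [::]; split => //; first by move=> S _; exact: rpred1.
  move=> r; exists 1 => S x _ _.
  have -> : in_subalg S 1 = 1 by apply: val_inj; rewrite in_subalgK ?rpred1.
  by rewrite hat1 normr1.
- move=> u v [Fu [FuV FuS hu]] [Fv [FvV FvS hv]]; exists (Fu ++ Fv).
  have subl S : {subset Fu ++ Fv <= S} -> {subset Fu <= S} /\ {subset Fv <= S}.
    by move=> h; split=> w wF; apply: h; rewrite mem_cat wF ?orbT.
  split.
  + by move=> w; rewrite mem_cat => /orP[/FuV|/FvV].
  + by move=> S /subl[/FuS uS /FvS vS]; rewrite rpredD// rpredZ.
  + move=> r; have [Mu hMu] := hu r; have [Mv hMv] := hv r.
    exists (`|c| * Mu + Mv) => S x /subl[uS vS] bx.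
    rewrite in_subalgD ?rpredZ ?in_subalgZ ?FuS ?FvS//.
    rewrite hatD hatZ; apply: le_trans (ler_normD _ _) _.
    apply: lerD; last exact: hMv.
    by rewrite normrM ler_wpM2l//; exact: hMu.
- move=> u v [Fu [FuV FuS hu]] [Fv [FvV FvS hv]]; exists (Fu ++ Fv).
  have subl S : {subset Fu ++ Fv <= S} -> {subset Fu <= S} /\ {subset Fv <= S}.
    by move=> h; split=> w wF; apply: h; rewrite mem_cat wF ?orbT.
  split.
  + by move=> w; rewrite mem_cat => /orP[/FuV|/FvV].
  + by move=> S /subl[/FuS uS /FvS vS]; rewrite rpredM.
  + move=> r; have [Mu hMu] := hu r; have [Mv hMv] := hv r.
    exists (Mu * Mv) => S x /subl[uS vS] bx.
    have -> : in_subalg S (u * v) = in_subalg S u * in_subalg S v.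
      apply: val_inj; rewrite in_subalgK ?rpredM ?FuS ?FvS//= -!/(val _).
      by rewrite !in_subalgK ?FuS ?FvS.
    by rewrite hatM normrM ler_pM//; [exact: hMu|exact: hMv].
Qed.

End CharacterBound.

(** * Second moments *)

Section LayerCake.
Context d (Y : measurableType d) (R : realType).
Variables (P : {measure set Y -> \bar R}) (Z : Y -> R).
Hypotheses (P1 : P setT = 1%E) (mZ : measurable_fun setT Z)
  (Z0 : forall y, 0 <= Z y).

Let B (t : R) (k : nat) := [set y | k.+1%:R * t < Z y].

Let mB t k : measurable (B t k).
Proof.
rewrite (_ : B t k = ~` [set y | Z y <= k.+1%:R * t]).
  apply: measurableC; rewrite -[X in measurable X]setTI.
  exact: (@measurable_fun_le _ _ _ setT Z (cst (k.+1%:R * t))).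
by apply/seteqP; split => y; rewrite /B/= ltNge => /negP.
Qed.

Let mindic t k D : measurable_fun D (fun y => (t * \1_(B t k) y)%:E : \bar R).
Proof.
by apply/measurable_EFinP; apply: measurable_funM => //; exact: measurable_indic.
Qed.

Let int_indic t k : 0 <= t -> (\int[P]_y (t * \1_(B t k) y)%:E = t%:E * P (B t k))%E.
Proof.
move=> t0; under eq_integral do rewrite EFinM.
rewrite ge0_integralZl//; first by rewrite integral_indic// setIT.
by apply/measurable_EFinP; exact: measurable_indic.
Qed.

Let step_le (t z : R) n : 0 < t -> 0 <= z ->
  \sum_(k < n) t * (k.+1%:R * t < z)%R%:R <= z.
Proof.
move=> t0 z0; elim: n => [|n IH]; first by rewrite big_ord0.
rewrite big_ord_recr/=; have [nz|] := boolP (_ < z); last by rewrite mulr0 addr0.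
apply: le_trans (ltW nz); rewrite mulr1 -natr1 mulrDl mul1r lerD2r.
apply: (@le_trans _ _ (\sum_(k < n) t)).
  by apply: ler_sum => k _; case: (_ < _); rewrite ?mulr1// mulr0 ltW.
by rewrite sumr_const card_ord mulr_natl.
Qed.

Lemma layer_cake_lower (t : R) n : 0 < t ->
  (t%:E * \sum_(k < n) P [set y | (k.+1%:R * t < Z y)%R] <= \int[P]_y (Z y)%:E)%E.
Proof.
move=> t0; rewrite ge0_sume_distrr; last by move=> k _; exact: measure_ge0.
under eq_bigr do rewrite -(int_indic _ (ltW t0)).
rewrite -ge0_integral_sum//; last first.
  by move=> k y _; rewrite lee_fin mulr_ge0// ltW.
apply: ge0_le_integral => //.
- by move=> y _; apply: sume_ge0 => k _; rewrite lee_fin mulr_ge0// ltW.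
- by apply: emeasurable_sum => k; exact: mindic.
- by apply/measurable_EFinP.
- move=> y _; rewrite sumEFin lee_fin; apply: le_trans (step_le n t0 (Z0 y)).
  by apply: ler_sum => k _; rewrite ler_pM2l// indicE mem_setE.
Qed.

(** Only the open superlevel sets of Z are measured, since a limit of measures
    is controlled from above on open sets. *)
Lemma layer_cake_upper (c : R) :
  (forall (t : R) n, 0 < t ->
    (t%:E * \sum_(k < n) P [set y | (k.+1%:R * t < Z y)%R] <= c%:E)%E) ->
  (\int[P]_y (Z y)%:E <= c%:E)%E.
Proof.
move=> h; apply/lee_addgt0Pr => e e0.
pose t := e / 2; have t0 : 0 < t by rewrite divr_gt0.
have t0' := ltW t0.
apply: (@le_trans _ _
    (\int[P]_y (e%:E + \sum_(0 <= k <oo) (t * \1_(B t k) y)%:E))%E).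
  apply: ge0_le_integral => //.
  - by move=> y _; rewrite lee_fin.
  - exact/measurable_EFinP.
  - apply: emeasurable_funD => //.
    apply: ge0_emeasurable_sum => k; first by move=> y _ _; rewrite lee_fin mulr_ge0.
    by move=> _; exact: mindic.
  move=> y _; pose n := Num.truncn (Z y / t).
  have /andP[n1 n2] : n%:R <= Z y / t < n.+1%:R.
    by apply: truncn_itv; rewrite divr_ge0.
  apply: (@le_trans _ _ (e%:E + \sum_(0 <= k < n.-1) (t * \1_(B t k) y)%:E)%E).
    rewrite sumEFin -EFinD lee_fin big_nat (eq_bigr (fun=> t)); last first.
      move=> k kn; rewrite indicE mem_set ?mulr1//.
      rewrite /B/= -ltr_pdivlMr//; apply: lt_le_trans n1.
      by rewrite ltr_nat; move: kn; case: (n).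
    rewrite -big_nat sumr_const_nat subn0 -mulr_natl.
    move: n2; rewrite ltr_pdivrMr// => /ltW/le_trans; apply.
    apply: (@le_trans _ _ (n.-1.+2%:R * t)).
      by rewrite ler_pM2r// ler_nat; case: (n).
    by rewrite -addn2 natrD mulrDl addrC lerD2r /t mulrC divfK.
  rewrite leeD2l//; apply: nneseries_lim_ge => k _ _.
  by rewrite lee_fin mulr_ge0.
rewrite ge0_integralD//; last 3 first.
- by move=> y _; rewrite lee_fin ltW.
- by move=> y _; apply: nneseries_ge0 => k _ _; rewrite lee_fin mulr_ge0.
- apply: ge0_emeasurable_sum => k; first by move=> y _ _; rewrite lee_fin mulr_ge0.
  by move=> _; exact: mindic.
rewrite integral_cst// P1 mule1 addeC leeD2r// integral_nneseries//; last first.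
  by move=> k y _; rewrite lee_fin mulr_ge0.
apply: lime_le.
  by apply: is_cvg_nneseries => k _ _; apply: integral_ge0 => y _; rewrite lee_fin mulr_ge0.
apply: nearW => n; rewrite big_mkord.
under eq_bigr do rewrite int_indic//.
by rewrite -ge0_sume_distrr//; exact: h.
Qed.

End LayerCake.

(** The bound on the second moments of a + t.1 is a polynomial inequality in t
    whose quadratic terms cancel; letting t vary over the real line turns it
    into an equality of the linear terms. *)
Lemma second_moments_representing (R : realType) (A : comAlgType R)
    (x0 : character A) (nu : {measure set (borel (charspace x0)) -> \bar R})
    (L : {scalar A}) :
  L 1 = 1 -> nu setT = 1%E ->
  (forall a, (\int[nu]_x ((hat x0 a x) ^+ 2)%:E <= (L (a ^+ 2))%:E)%E) ->
  representing nu L.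
Proof.
move=> L1 nu1 h a.
have mh b : measurable_fun setT (hat x0 b : borel (charspace x0) -> R).
  by apply: continuous_borel_real; exact: hat_continuous.
have int2 b : nu.-integrable setT (EFin \o (fun x => (hat x0 b x) ^+ 2)).
  apply/integrableP; split; first by apply/measurable_EFinP; exact: measurable_funM.
  under eq_integral do rewrite /= ger0_norm ?sqr_ge0//.
  exact: le_lt_trans (h b) (ltry _).
have intc (c : R) : nu.-integrable setT (EFin \o (cst c : borel (charspace x0) -> R)).
  apply/integrableP; split; first exact/measurable_EFinP.
  rewrite (_ : (\int[nu]_x _)%E = `|c|%:E) ?ltry//.
  by have := integral_cst nu measurableT `|c|%:E; rewrite nu1 mule1.
have int1 b : nu.-integrable setT (EFin \o hat x0 b).
  pose g1 : borel (charspace x0) -> R := cst 1.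
  pose g2 : borel (charspace x0) -> R := fun x => (hat x0 b x) ^+ 2.
  apply: (@le_integrable _ (borel (charspace x0)) R nu setT measurableT _
      ((EFin \o g1) \+ (EFin \o g2))).
  - exact/measurable_EFinP.
  - move=> x _; rewrite /= lee_fin [leRHS]ger0_norm ?addr_ge0 ?sqr_ge0//.
    have sq z : `|z| <= 1 + z ^+ 2 :> R.
      have -> : z ^+ 2 = `|z| ^+ 2 by rewrite -normrX ger0_norm ?sqr_ge0.
      have := normr_ge0 z; have := sqr_ge0 (`|z| - 1); lra.
    exact: sq.
  - by apply: integrableD => //; [exact: (intc 1)|exact: (int2 b)].
have fin1 b : (\int[nu]_x (hat x0 b x)%:E)%E \is a fin_num.
  exact: (integrable_fin_num measurableT (int1 b)).
have fin2 b : (\int[nu]_x ((hat x0 b x) ^+ 2)%:E)%E \is a fin_num.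
  exact: (integrable_fin_num measurableT (int2 b)).
split; first exact: int1.
rewrite -(fineK (fin1 a)); congr (_%:E).
have := fineK (fin1 a); have := fineK (fin2 a).
set e1 := fine (\int[nu]_x (hat x0 a x)%:E)%E.
set e2 := fine (\int[nu]_x ((hat x0 a x) ^+ 2)%:E)%E => E2 E1.
have key (t : R) : e2 + 2 * t * e1 + t ^+ 2 <= L (a ^+ 2) + 2 * t * L a + t ^+ 2.
  have LE : L ((a + t *: 1) ^+ 2) = L (a ^+ 2) + 2 * t * L a + t ^+ 2.
    rewrite sqrrD -scalerAr mulr1 exprZn expr1n -mulr_natl.
    rewrite linearD linearD linearZ/= L1 mulr1 mulr_natl -scaler_nat !linearZ/=.
    by rewrite mulrA.
  have := h (a + t *: 1); rewrite LE.
  under eq_integral do rewrite hatD hatZ hat1 mulr1.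
  rewrite (_ : (\int[nu]_x _)%E = (e2 + 2 * t * e1 + t ^+ 2)%:E).
    by rewrite lee_fin.
  pose F2 : borel (charspace x0) -> \bar R := EFin \o (fun x => hat x0 a x ^+ 2).
  pose F1 : borel (charspace x0) -> \bar R := EFin \o hat x0 a.
  pose F0 : borel (charspace x0) -> \bar R := EFin \o cst (t ^+ 2).
  have i1 : nu.-integrable setT (fun x => ((2 * t)%:E * F1 x)%E).
    exact: (integrableZl measurableT (2 * t) (int1 a)).
  have i0 : nu.-integrable setT F0 by exact: intc.
  transitivity (\int[nu]_x (F2 x + (2 * t)%:E * F1 x + F0 x))%E.
    apply: eq_integral => x _; rewrite /F2 /F1 /F0/= -EFinM -!EFinD.
    by congr (_%:E); lra.
  rewrite (integralD measurableT (integrableD measurableT (int2 a) i1) i0).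
  rewrite (integralD measurableT (int2 a) i1) (integralZl measurableT (int1 a)).
  rewrite /F2 /F1 /comp -E1 -E2 -EFinM -EFinD [in RHS]EFinD; congr (_ + _)%E.
  by have := integral_cst nu measurableT (t ^+ 2)%:E; rewrite nu1 mule1.
apply/eqP; apply: contraT => ne.
have ne' : e1 - L a != 0 by rewrite subr_eq0.
have := key ((L (a ^+ 2) - e2 + 1) / (2 * (e1 - L a))).
set t := _ / _; have : t * (e1 - L a) = (L (a ^+ 2) - e2 + 1) / 2.
  by rewrite /t invfM mulrA divfK.
move=> tE ht; exfalso; lra.
Qed.

(** * From concentrated families to a Radon measure *)

Definition image_measure d d' (T1 : measurableType d) (T2 : measurableType d')
    (R : realType) (m : {measure set T1 -> \bar R}) (f : T1 -> T2)
    (mf : measurable_fun setT f) : {measure set T2 -> \bar R} :=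
  measure_function_pushforward__canonical__measure_function_Measure m mf.

Section ContinuousArithmetic.
Variables (R : realType) (T : topologicalType).
Implicit Types f g : T -> R.

Lemma fun_continuous_cst (c : R) : continuous (fun _ : T => c).
Proof. by move=> x; exact: cvg_cst. Qed.

Lemma fun_continuousB f g : continuous f -> continuous g ->
  continuous (fun x => f x - g x).
Proof. by move=> cf cg x; apply: cvgB; [exact: cf|exact: cg]. Qed.

Lemma fun_continuousD f g : continuous f -> continuous g ->
  continuous (fun x => f x + g x).
Proof. by move=> cf cg x; apply: cvgD; [exact: cf|exact: cg]. Qed.

Lemma fun_continuousM f g : continuous f -> continuous g ->
  continuous (fun x => f x * g x).
Proof. by move=> cf cg x; apply: cvgM; [exact: cf|exact: cg]. Qed.

Lemma fun_continuous_sqr f : continuous f -> continuous (fun x => f x ^+ 2).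
Proof. by move=> cf; exact: (fun_continuousM cf cf). Qed.

Lemma fun_continuous_norm f : continuous f -> continuous (fun x => `|f x|).
Proof. by move=> cf x; apply: cvg_norm; exact: cf. Qed.

Lemma open_fun_gt f (c : R) : continuous f -> open [set x | c < f x].
Proof.
move=> cf; rewrite [X in open X](_ : _ = f @^-1` [set s | c < s])//.
by apply: open_comp; [move=> x _; exact: cf|exact: open_gt].
Qed.

End ContinuousArithmetic.

Section HomFunctions.
Variables (R : realType) (A : comAlgType R) (x0 : character A).
Local Notation T := (realfun A R).
Local Notation index := (unit + R * A * A + A * A)%type.

(** The failures of all relations defining a character form one family of open
    sets, so that closedness and null sets are treated once for all of them. *)
Definition hom_defect (i : index) : set T :=
  match i with
  | inl (inl _) => [set f | f 1 - 1 != 0]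
  | inl (inr (c, u, v)) => [set f | f (c *: u + v) - (c * f u + f v) != 0]
  | inr (u, v) => [set f | f (u * v) - f u * f v != 0]
  end.

Definition hom_functions : set T := ~` \bigcup_i hom_defect i.

Lemma hom_functionsP (f : T) : hom_functions f <->
  [/\ f 1 = 1, forall c u v, f (c *: u + v) = c * f u + f v &
      forall u v, f (u * v) = f u * f v].
Proof.
split=> [Hf|[f1 fL fM]].
  have Hi i : ~ hom_defect i f by move=> fi; apply: Hf; exists i.
  split=> [|c u v|u v]; apply/eqP; rewrite -subr_eq0; apply/negPn/negP.
  - exact: (Hi (inl (inl tt))).
  - exact: (Hi (inl (inr (c, u, v)))).
  - exact: (Hi (inr (u, v))).
move=> [[[[]|[[c u] v]]|[u v]] _ /=].
- by rewrite f1 subrr eqxx.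
- by rewrite fL subrr eqxx.
- by rewrite fM subrr eqxx.
Qed.

Lemma hom_defect_open i : open (hom_defect i).
Proof.
have ev := @realfun_eval_continuous R A.
have op (h : T -> R) : continuous h -> open [set f | h f != 0].
  move=> ch; rewrite [X in open X](_ : _ = h @^-1` [set s | s != 0])//.
  by apply: open_comp; [move=> x _; exact: ch|exact: open_neq].
case: i => [[[]|[[c u] v]]|[u v]]; apply: op.
- exact (fun_continuousB (ev 1) (@fun_continuous_cst R T 1)).
- have cM := fun_continuousM (@fun_continuous_cst R T c) (ev u).
  exact (fun_continuousB (ev _) (fun_continuousD cM (ev v))).
- exact (fun_continuousB (ev _) (fun_continuousM (ev u) (ev v))).
Qed.

Lemma hom_functions_closed : closed hom_functions.
Proof.
by apply: open_closedC; apply: bigcup_open => i _; exact: hom_defect_open.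
Qed.

Lemma hom_function_character (f : T) : hom_functions f ->
  exists x : charspace x0, forall a, hat x0 a x = f a.
Proof.
move=> /hom_functionsP[f1 fL fM].
have lin : linear_for *%R f by move=> c u v; exact: fL.
have mul : monoid_morphism f by split.
pose fl := GRing.isLinear.Build R A R *%R f lin.
pose fm := GRing.isMonoidMorphism.Build A R f mul.
pose x : character A := HB.pack f fl fm.
by exists x.
Qed.

Definition to_character (f : T) : charspace x0 :=
  xget (x0 : charspace x0) [set x : charspace x0 | forall a, hat x0 a x = f a].

Lemma to_characterE f a : hom_functions f -> hat x0 a (to_character f) = f a.
Proof.
move=> /hom_function_character[x xf]; rewrite /to_character.
by case: xgetP => [y _|/(_ x)]; [exact|move=> /(_ xf)].
Qed.

Lemma to_character_out f : ~ hom_functions f -> to_character f = x0.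
Proof.
move=> nHf; rewrite /to_character; case: xgetP => // y _ yf; exfalso.
apply/nHf/hom_functionsP; split => [|c u v|u v]; rewrite -!yf.
- exact: hat1.
- by rewrite hatD hatZ.
- exact: hatM.
Qed.

Lemma to_character_continuous : {within hom_functions, continuous to_character}.
Proof.
apply/subspace_continuousP => f Hf; apply: cvg_charspace => a N.
rewrite to_characterE// => Nf.
have := @realfun_eval_continuous R A a f N Nf.
apply: (@filterS _ (nbhs f) (nbhs_filter f)) => g Ng Hg /=.
by rewrite -[_ g]/(to_character g) to_characterE.
Qed.

End HomFunctions.

Section Transfer.
Variables (R : realType) (A : comAlgType R) (x0 : character A)
  (Fv : A -> seq A).

(** Characters of S as functions on all of A; at a the value is kept only if
    S contains the list Fv a on which the bounds at a depend. *)
Definition transfer (S : subalgClosed A) (x : charspace (char_res S x0)) :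
    realfun A R :=
  fun a => if all (fun b => b \in S) (Fv a)
           then hat (char_res S x0) (in_subalg S a) x else 0.

Lemma transfer_continuous S : continuous (@transfer S).
Proof.
move=> x; have FF := @fmap_filter _ _ (@transfer S) _ (nbhs_filter x).
apply: (cvg_realfun FF) => a.
suff : transfer y a @[y --> x] --> transfer x a by [].
rewrite /transfer; case: ifPn => _; first exact: hat_continuous.
exact: (@cvg_cst _ _ _ _ (nbhs_filter x)).
Qed.

Lemma transferE S (x : charspace (char_res S x0)) a :
  {subset Fv a <= S} -> transfer x a = hat (char_res S x0) (in_subalg S a) x.
Proof. by move=> aS; rewrite /transfer; case: allP => // -[]. Qed.

Lemma transfer_bound S (x : charspace (char_res S x0)) a (c : R) : 0 <= c ->
  ({subset Fv a <= S} -> `|hat (char_res S x0) (in_subalg S a) x| <= c) ->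
  `|transfer x a| <= c.
Proof.
move=> c0 h; rewrite /transfer; case: allP => [aS|_]; first exact: h.
by rewrite normr0.
Qed.

Definition hom_support (i : unit + R * A * A + A * A) : seq A :=
  match i with
  | inl (inl _) => Fv 1
  | inl (inr (c, u, v)) => Fv (c *: u + v) ++ (Fv u ++ Fv v)
  | inr (u, v) => Fv (u * v) ++ (Fv u ++ Fv v)
  end.

Lemma transfer_hom_defect S i (x : charspace (char_res S x0)) :
  (forall a, {subset Fv a <= S} -> a \in S) -> {subset hom_support i <= S} ->
  ~ hom_defect i (transfer x).
Proof.
move=> FvS; have subl (s t : seq A) : {subset s ++ t <= S} ->
    {subset s <= S} /\ {subset t <= S}.
  by move=> h; split=> w wF; apply: h; rewrite mem_cat wF ?orbT.
case: i => [[[]|[[c u] v]]|[u v]] /=.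
- move=> h1; rewrite transferE//.
  have -> : in_subalg S 1 = 1 by apply: val_inj; rewrite in_subalgK ?rpred1.
  by rewrite hat1 subrr eqxx.
- move=> /subl[h1 /subl[hu hv]]; rewrite !transferE//.
  have uS := FvS _ hu; have vS := FvS _ hv.
  by rewrite in_subalgD ?rpredZ// in_subalgZ// hatD hatZ subrr eqxx.
- move=> /subl[h1 /subl[hu hv]]; rewrite !transferE//.
  have uS := FvS _ hu; have vS := FvS _ hv.
  have -> : in_subalg S (u * v) = in_subalg S u * in_subalg S v.
    apply: val_inj; rewrite in_subalgK ?rpredM//= -!/(val _).
    by rewrite !in_subalgK.
  by rewrite hatM subrr eqxx.
Qed.

End Transfer.

Section Backward.
Variables (R : realType) (A : comAlgType R) (x0 : character A)
  (V : submodClosed A) (p q : hilbertian_seminorm (subspace_of V))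
  (L : {scalar A})
  (nu : forall S : subalgClosed A,
     {measure set (borel (charspace (char_res S x0))) -> \bar R}).
Hypotheses (genV : generated_by [set` V]) (L1 : L 1 = 1)
  (trace_fin : (seminorm_trace p q < +oo)%E)
  (nuJ : forall S, fin_gen_subalgs V S ->
     radon (nu S) /\ representing (nu S) (L \o val))
  (nuC : concentrated (fin_gen_subalgs V) p nu).
Local Notation J := (fin_gen_subalgs V).
Local Notation X := (charspace x0).
Local Notation T := (realfun A R).

Lemma representing_setT S : J S -> nu S setT = 1%E.
Proof.
move=> /nuJ[_ /(_ 1)[_]] /=; rewrite L1 => <-.
have := integral_cst (nu S) measurableT 1%E; rewrite mul1e => <-.
by apply: eq_integral => x _; rewrite hat1.
Qed.

Lemma trace_null v : q v = 0 -> p v = 0.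
Proof.
move: v; move: trace_fin; rewrite /seminorm_trace; case: ifPn => [/asboolP//|_].
by rewrite ltxx.
Qed.

Lemma trace_bound : exists2 c : R, 0 <= c & (seminorm_trace p q <= c%:E)%E.
Proof.
case: (seminorm_trace p q) trace_fin => [r _||_] //.
  by exists `|r| => //; rewrite lee_fin ler_norm.
by exists 0; rewrite ?leNye.
Qed.

(** The radius n + 1 makes the contribution of the trace at most e / 2. *)
Lemma escape_uniform (e : R) : 0 < e -> exists n : nat, forall S, J S ->
  (nu S (\bigcup_(v in [set v : subspace_of V | val v \in S])
     @escape R A x0 V q S n.+1%:R v) <= e%:E)%E.
Proof.
move=> e0; have [c c0 trc] := trace_bound.
have e10 : 0 < e / 10 by rewrite divr_gt0.
have [d d0 hd] := nuC e10.
pose n := Num.truncn (40 * c / (d ^+ 2 * e)); exists n => S JS.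
have [rS _] := nuJ JS.
apply: (@le_trans _ _ (5 * (e / 10 + 4 * c / (n.+1%:R ^+ 2 * d ^+ 2)))%:E).
  apply: (@escape_bound _ _ _ _ p) => //.
  - exact: representing_setT.
  - move=> e' /nuC[d' d'0 hd']; exists d' => // v a va pv.
    exact: hd' va pv.
  - exact: trace_null.
  - exact: ltW.
  - by move=> v a va pv; exact: hd va pv.
rewrite lee_fin mulrDr.
have d20 : 0 < d ^+ 2 by rewrite exprn_gt0.
have : 40 * c / (d ^+ 2 * e) <= n.+1%:R ^+ 2.
  apply: (@le_trans _ _ n.+1%:R); first by apply: ltW; exact: truncnS_gt.
  by rewrite expr2 ler_peMl// ler1n.
rewrite ler_pdivrMr ?mulr_gt0// => h.
have : 4 * c / (n.+1%:R ^+ 2 * d ^+ 2) <= e / 10.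
  rewrite ler_pdivrMr ?mulr_gt0 ?exprn_gt0 ?ltr0n//; lra.
move: (4 * c / _) => y hy; lra.
Qed.

(** An ultrafilter containing all tails of the directed set of subalgebras
    chooses limits of all the numbers nu S B at once, without compatibility of
    the measures nu S. *)
Lemma cofinal_ultrafilter : exists F : set_system (subalgClosed A),
  UltraFilter F /\ forall s : seq A, {subset s <= V} ->
    \forall S \near F, J S /\ {subset s <= S}.
Proof.
pose B (s : seq A) : set (subalgClosed A) := [set S | J S /\ {subset s <= S}].
pose F0 := filter_from [set s : seq A | {subset s <= V}] B.
have FF0 : ProperFilter F0.
  apply: filter_from_proper.
    apply: filter_from_filter; first by exists [::].
    move=> s t sV tV; exists (s ++ t).
      by move=> a; rewrite mem_cat => /orP[/sV|/tV].
    move=> S [JS sS]; split; split => // a ast; apply: sS; rewrite mem_cat ast//.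
    by rewrite orbT.
  move=> s /fin_gen_subalgs_cofinal[S JS sS]; exists S; split => //.
have [F [UF F0F]] := ultraFilterLemma FF0.
by exists F; split => // s sV; apply: F0F; exists s.
Qed.

Theorem concentrated_representing :
  exists nu' : {measure set (borel X) -> \bar R},
    [/\ radon nu', representing nu' L & supported_in nu' (continuous_chars q x0)].
Proof.
have [Fv hF] := choice (fun a => char_bound x0 q a genV).
have FvV a : {subset Fv a <= V} by have [] := hF a.
have Fvb a r : exists M : R, forall (S : subalgClosed A) x,
    {subset Fv a <= S} -> bounded_by q r x ->
    `|hat (char_res S x0) (in_subalg S a) x| <= M.
  by have [_ _] := hF a; exact.
have [M hM] := choice (fun ar : A * R => Fvb ar.1 ar.2).
pose f S : borel (charspace (char_res S x0)) -> borel T := @transfer R A x0 Fv S.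
have mf S : measurable_fun setT (f S).
  by apply: continuous_borel; exact: transfer_continuous.
pose mI S := image_measure (nu S) (mf S).
have mIE S B : mI S B = nu S (f S @^-1` B) by [].
have [F [UF nearF]] := cofinal_ultrafilter.
have hT : hausdorff_space T by exact: realfun_hausdorff.
have rT : regular_space T by exact: uniform_regular.
have nearJ : \forall S \near F, J S.
  have h : {subset [::] <= V} by [].
  by apply: filterS (nearF _ h) => S [].
have mI1 : \forall S \near F, mI S setT = 1%E.
  by apply: filterS nearJ => S JS; rewrite mIE preimage_setT representing_setT.
have mIle S (O : set T) (W : set (charspace (char_res S x0))) :
    open O -> open W -> f S @^-1` O `<=` W -> (mI S O <= nu S W)%E.
  move=> oO oW OW; rewrite mIE; apply: le_measure => //; rewrite ?inE.
    by rewrite -[X in measurable X]setTI; apply: (mf) => //; exact: borel_open.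
  exact: borel_open.
have tight (e : R) : 0 < e ->
    exists2 K, compact K & \forall S \near F, (mI S (~` K : set T) <= e%:E)%E.
  move=> /escape_uniform[n hn].
  (* The absolute value of M puts 0, the value of transfer off its support,
     inside the box. *)
  exists [set g : T | forall a, `|g a| <= `|M (a, n.+1%:R)|].
    exact: realfun_box_compact.
  apply: filterS nearJ => S JS; apply: le_trans (hn S JS).
  apply: mIle.
  - apply: closed_openC; apply: compact_closed => //; exact: realfun_box_compact.
  - by apply: bigcup_open => v _; exact: escape_open.
  - move=> x /= nK; apply: contrapT => nE; apply: nK => a.
    apply: transfer_bound => // aS.
    apply: le_trans (ler_norm _); apply: (hM (a, n.+1%:R)) => // v vS.
    by rewrite leNgt; apply/negP => esc; apply: nE; exists v.
have [mu [rmu mu1 muO]] := ultra_radon UF hT rT mI1 tight.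
have mu_open (O : set T) (c : R) : open O ->
    (\forall S \near F, (mI S O <= c%:E)%E) -> (mu O <= c%:E)%E.
  move=> oO hO; have := muO 1%N (fun=> O) c (fun=> oO).
  by rewrite big_ord1; apply; apply: filterS hO => S; rewrite big_ord1.
have hom0 i : mu (hom_defect i) = 0%E.
  apply/eqP; rewrite -measure_le0; apply: mu_open; first exact: hom_defect_open.
  have iV : {subset hom_support Fv i <= V}.
    case: i => [[[]|[[c u] v]]|[u v]] /=; first exact: FvV.
    - by move=> w; rewrite !mem_cat => /or3P[] /FvV.
    - by move=> w; rewrite !mem_cat => /or3P[] /FvV.
  apply: filterS (nearF _ iV) => S [_ iS].
  rewrite mIE (_ : _ @^-1` _ = set0) ?measure0//.
  apply/seteqP; split => // x; apply: transfer_hom_defect => // a.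
  by have [_ + _] := hF a; apply.
have H0 : mu (~` @hom_functions R A) = 0%E.
  rewrite /hom_functions setCK; apply: radon_bigcup_null => //.
  exact: hom_defect_open.
have cH := @hom_functions_closed R A.
have cg := @to_character_continuous R A x0.
have mg := within_closed_borel cH cg (@to_character_out R A x0).
pose nu' := image_measure mu mg.
have nu'E B : nu' B = mu (to_character x0 @^-1` B) by [].
have nu'_le (B : set (borel X)) (O : set T) : measurable B -> open O ->
    (forall h, hom_functions h -> B (to_character x0 h) -> O h) ->
    (nu' B <= mu O)%E.
  move=> mB oO BO; have mO := borel_open oO.
  have mHC := borel_open (closed_openC cH).
  rewrite nu'E; apply: (@le_trans _ _ (mu (O `|` ~` @hom_functions R A))).
    apply: le_measure; rewrite ?inE.
    - by rewrite -[X in measurable X]setTI; exact: (mg).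
    - exact: (@measurableU _ (borel T)).
    - move=> h Bh; have [Hh|nHh] := pselect (hom_functions h); last by right.
      by left; exact: BO.
  have := @measureU2 _ (borel T) R mu _ _ mO mHC.
  by move=> /le_trans; apply; rewrite [X in (_ + X)%E]H0 adde0.
have nu'1 : nu' setT = 1%E by rewrite nu'E preimage_setT.
exists nu'; split.
- apply: (radon_image hT (@charspace_hausdorff _ _ x0) cH H0 cg mg rmu) => //.
  by rewrite mu1 ltry.
- apply: second_moments_representing => // a.
  have mh b : measurable_fun setT (hat x0 b : borel X -> R).
    by apply: continuous_borel_real; exact: hat_continuous.
  apply: (@layer_cake_upper _ (borel X) R nu' _ nu'1).
  + exact: measurable_funM.
  + by move=> x; exact: sqr_ge0.
  move=> t n t0; rewrite -lee_pdivlMl//.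
  pose O (k : nat) : set T := [set h | k.+1%:R * t < (h a) ^+ 2].
  have oO k : open (O k).
    have := @realfun_eval_continuous R A a.
    by move=> /fun_continuous_sqr/open_fun_gt; exact.
  apply: (@le_trans _ _ (\sum_(k < n) mu (O k))%E).
    apply: lee_sum => k _; apply: nu'_le => //.
      apply: borel_open; apply: open_fun_gt; apply: fun_continuous_sqr.
      exact: hat_continuous.
    by move=> h Hh /=; rewrite to_characterE.
  rewrite -EFinM; apply: muO => //.
  apply: filterS (nearF _ (FvV a)) => S [JS aS].
  have [_ reprS] := nuJ JS.
  rewrite EFinM lee_pdivlMl//.
  pose b := in_subalg S a.
  have aSS : a \in S by have [_ + _] := hF a; apply.
  apply: (@le_trans _ _ (\int[nu S]_x ((hat (char_res S x0) b x) ^+ 2)%:E)%E).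
    under eq_bigr do rewrite mIE.
    rewrite (eq_bigr (fun k : 'I_n => nu S
      [set x | k.+1%:R * t < (hat (char_res S x0) b x) ^+ 2])); last first.
      move=> k _; congr (nu S _); apply/seteqP; split => x;
        by rewrite /O/= /f transferE.
    apply: layer_cake_lower => //.
      by apply: continuous_borel_real; apply: fun_continuous_sqr; exact: hat_continuous.
    by move=> x; exact: sqr_ge0.
  have [_] := reprS (b ^+ 2).
  under eq_integral do rewrite hatM -expr2.
  move=> ->; rewrite lee_fin /= -!/(val _) /b.
  by rewrite in_subalgK.
- pose O n : set T :=
    \bigcup_(v : subspace_of V) [set h | n.+1%:R * q v < `|h (val v)|].
  pose W n : set X :=
    \bigcup_(v : subspace_of V) [set x | n.+1%:R * q v < `|hat x0 (val v) x|].
  have oO n (v : subspace_of V) : open [set h : T | n.+1%:R * q v < `|h (val v)|].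
    apply: open_fun_gt; apply: fun_continuous_norm.
    exact: realfun_eval_continuous.
  have oW n : open (W n).
    apply: bigcup_open => v _; apply: open_fun_gt; apply: fun_continuous_norm.
    exact: hat_continuous.
  exists (\bigcap_n W n); split.
  + by apply: bigcapT_measurable => n; exact: borel_open.
  + apply/eqP; rewrite -measure_le0; apply/lee_addgt0Pr => e.
    rewrite add0e => /escape_uniform[n hn].
    apply: (@le_trans _ _ (nu' (W n))).
      apply: le_measure; rewrite ?inE.
      * by apply: bigcapT_measurable => k; exact: borel_open.
      * exact: borel_open.
      * by apply: bigcap_inf.
    apply: (@le_trans _ _ (mu (O n))).
      apply: nu'_le; [exact: borel_open|by apply: bigcup_open => v _; exact: oO|].
      by move=> h Hh [v _ /=]; rewrite to_characterE// => hv; exists v.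
    apply: radon_bigcup_open => // E _; apply: mu_open.
      by apply: bigcup_open => v _; exact: oO.
    apply: filterS nearJ => S JS; apply: le_trans (hn S JS); apply: mIle.
    * by apply: bigcup_open => v _; exact: oO.
    * by apply: bigcup_open => v _; exact: escape_open.
    * move=> x [v _ /=]; rewrite /f /transfer; case: allP => [vS esc|_].
        by exists v => //=; have [_ + _] := hF (val v); apply.
      by rewrite normr0 ltNge mulr_ge0// hnorm_ge0.
  + move=> x nx n _; apply: contrapT => nW; apply: nx.
    exists n.+1%:R; first by rewrite ltr0n.
    by move=> v; rewrite leNgt; apply/negP => h; apply: nW; exists v.
Qed.

End Backward.

(** * From a Radon measure to a concentrated family *)

Section Forward.
Variables (R : realType) (A : comAlgType R) (x0 : character A)
  (V : submodClosed A) (q : hilbertian_seminorm (subspace_of V))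
  (L : {scalar A}) (nu : {measure set (borel (charspace x0)) -> \bar R}).
Hypotheses (L1 : L 1 = 1) (nu_radon : radon nu) (nu_repr : representing nu L)
  (nu_supp : supported_in nu (continuous_chars q x0)).
Local Notation X := (charspace x0).
Local Notation ev v x := (hat x0 (\val v) x).

Lemma repr_setT : nu setT = 1%E.
Proof.
have [_] := nu_repr 1; rewrite L1 => <-.
have := integral_cst nu measurableT 1%E; rewrite mul1e => <-.
by apply: eq_integral => x _; rewrite hat1.
Qed.

Definition norm_ball (n : nat) : set X :=
  [set x | forall v : subspace_of V, `|ev v x| <= n.+1%:R * q v].

Lemma hat_measurable a : measurable_fun setT (hat x0 a : borel X -> R).
Proof. by apply: continuous_borel_real; exact: hat_continuous. Qed.

Lemma norm_ballC_open n : open (~` norm_ball n).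
Proof.
rewrite (_ : ~` _ = \bigcup_(v : subspace_of V) [set x | n.+1%:R * q v < `|ev v x|]).
  apply: bigcup_open => v _; apply: open_fun_gt; apply: fun_continuous_norm.
  exact: hat_continuous.
apply/seteqP; split => x /= => [nx|[v _ /=]].
  apply: contrapT => nv; apply: nx => v.
  by rewrite leNgt; apply/negP => h; apply: nv; exists v.
by move=> h /(_ v); rewrite leNgt h.
Qed.

Lemma norm_ball_measurable n : measurable (norm_ball n : set (borel X)).
Proof.
rewrite -(setCK (norm_ball n)); apply: (@measurableC _ (borel X)).
exact: borel_open (norm_ballC_open n).
Qed.

Lemma norm_ball_nondecreasing m n : (m <= n)%N -> norm_ball m `<=` norm_ball n.
Proof.
move=> mn x mx v; apply: le_trans (mx v) _.
by rewrite ler_wpM2r ?hnorm_ge0// ler_nat ltnS.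
Qed.

Lemma norm_ball_exhaust (e : R) : 0 < e ->
  exists n, (nu (~` norm_ball n) <= e%:E)%E.
Proof.
move=> e0.
have mC n : measurable (~` norm_ball n : set (borel X)).
  by apply: borel_open; exact: norm_ballC_open.
have mI : measurable (\bigcap_n ~` norm_ball n : set (borel X)).
  exact: bigcapT_measurable.
have n0 : nu (\bigcap_n ~` norm_ball n) = 0%E.
  apply: measure_negligible => //; apply: negligibleS nu_supp => x nx [C C0 xC].
  have := nx (Num.truncn C) I; apply => v; apply: le_trans (xC v) _.
  by rewrite ler_wpM2r ?hnorm_ge0// ltW// truncnS_gt.
have cv : nu (~` norm_ball n) @[n --> \oo] --> 0%E.
  rewrite -n0; apply: (@nonincreasing_cvg_mu _ (borel X) R nu) => //.
    apply: (@le_lt_trans _ _ (nu setT)); last by rewrite repr_setT ltry.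
    by apply: le_measure; rewrite ?inE.
  move=> m n mn; apply/subsetPset; apply: subsetC; exact: norm_ball_nondecreasing.
apply: contrapT => hn.
have : (e%:E <= 0)%E.
  rewrite -(cvg_lim (@ereal_hausdorff R) cv); apply: lime_ge.
    by apply/cvg_ex; exists 0%E.
  apply: nearW => n; rewrite leNgt; apply/negP => lt; apply: hn; exists n.
  exact: ltW.
by rewrite lee_fin leNgt e0.
Qed.

(** A bounded weight comparable with the inverse square of the norm of x as a
    functional on (V, q), and zero where x is not q-continuous. *)
Definition weights (x : X) : set R :=
  [set n.+1%:R ^- 2 | n in [set n : nat | norm_ball n x]].

Definition weight (x : borel X) : R := sup (weights x).

Lemma weights_ubound x : ubound (weights x) 1.
Proof.
move=> _ [n _ <-]; rewrite invf_le1 ?exprn_gt0//.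
by rewrite exprn_ege1// ler1n.
Qed.

Lemma weight_lb n x : norm_ball n x -> n.+1%:R ^- 2 <= weight x.
Proof.
move=> nx; apply: ub_le_sup; last by exists n.
by exists 1; exact: weights_ubound.
Qed.

Lemma weight0 x : ~ (exists n, norm_ball n x) -> weight x = 0.
Proof.
move=> nx; rewrite /weight (_ : weights x = set0) ?sup0//.
by apply/seteqP; split => // y [n xn _]; apply: nx; exists n.
Qed.

Lemma weight_ge0 x : 0 <= weight x.
Proof.
have [[n nx]|/weight0->//] := pselect (exists n, norm_ball n x).
by apply: le_trans (weight_lb nx); rewrite invr_ge0 exprn_ge0.
Qed.

Lemma weight_le1 x : weight x <= 1.
Proof.
have [[n nx]|/weight0->//] := pselect (exists n, norm_ball n x).
by apply: ge_sup; [exists (n.+1%:R ^- 2), n|exact: weights_ubound].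
Qed.

Lemma weight_mul_le x (s c : R) : 0 <= s -> 0 <= c ->
  (forall n, norm_ball n x -> s <= c * n.+1%:R ^+ 2) -> weight x * s <= c.
Proof.
move=> s0 c0 h; have [[n nx]|/weight0->] := pselect (exists n, norm_ball n x);
  last by rewrite mul0r.
have [->|sn0] := eqVneq s 0; first by rewrite mulr0.
have {sn0}s_gt0 : 0 < s by rewrite lt_neqAle eq_sym sn0.
rewrite -ler_pdivlMr//; apply: ge_sup; first by exists (n.+1%:R ^- 2), n.
move=> _ [k kx <-]; rewrite ler_pdivlMr// mulrC ler_pdivrMr ?exprn_gt0//.
exact: h.
Qed.

Lemma weight_measurable : measurable_fun setT weight.
Proof.
apply: (@measurability _ _ (borel X) R setT weight _ (RGenOInfty.measurableE R)).
move=> _ [_ [t ->] <-]; rewrite setTI set_itvoy.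
have [t0|t0] := ltP t 0.
  rewrite (_ : _ @^-1` _ = setT); first exact: (@measurableT _ (borel X)).
  by apply/seteqP; split => // x _ /=; apply: lt_le_trans t0 (weight_ge0 x).
rewrite (_ : _ @^-1` _ =
    \bigcup_(n in [set n : nat | t < n.+1%:R ^- 2]) norm_ball n).
  by apply: (@bigcup_measurable _ (borel X)) => n _; exact: norm_ball_measurable.
apply/seteqP; split => x /=; last first.
  by move=> [n /= tn nx]; apply: lt_le_trans tn (weight_lb nx).
move=> tw; have [[k kx]|nx] := pselect (exists n, norm_ball n x); last first.
  by move: tw; rewrite (weight0 nx) ltNge t0.
have [|_ [n nx <-] tn] := @sup_gt R (weights x) t _ tw.
  by exists (k.+1%:R ^- 2), k.
by exists n.
Qed.

Let wf (u v : subspace_of V) (x : borel X) : R := hat x0 (\val u * \val v) x * weight x.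

Let wf_integrable u v : nu.-integrable setT (EFin \o wf u v).
Proof.
have [int _] := nu_repr (\val u * \val v).
apply: le_integrable int => //.
  apply/measurable_EFinP; apply: measurable_funM; first exact: hat_measurable.
  exact: weight_measurable.
move=> x _; rewrite /= lee_fin normrM (ger0_norm (weight_ge0 x)).
by rewrite ler_piMr// weight_le1.
Qed.

(** The second moment of v itself would not do: its trace is the second moment
    of the norm of the character, which may be infinite. *)
Definition weighted_form (u v : subspace_of V) : R := \int[nu]_x wf u v x.

Lemma weighted_form_sym u v : weighted_form u v = weighted_form v u.
Proof. by apply: eq_Rintegral => x _; rewrite /wf mulrC [in RHS]mulrC [\val u * _]mulrC. Qed.

Lemma weighted_form_linear w : linear_for *%R (weighted_form ^~ w).
Proof.
move=> a u v; rewrite /weighted_form.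
have intZ : nu.-integrable setT (EFin \o (fun x => a * wf u w x)).
  rewrite (_ : _ \o _ = (fun x => (a%:E * (EFin \o wf u w) x)%E)).
    exact: integrableZl.
  by apply/funext => x; rewrite /= EFinM.
rewrite -(RintegralZl a measurableT (wf_integrable u w)).
rewrite -(RintegralD measurableT intZ (wf_integrable v w)).
apply: eq_Rintegral => x _; rewrite /wf/= -!/(val _) mulrDl -scalerAl hatD hatZ.
by rewrite mulrDl mulrA.
Qed.

Lemma weighted_form_bilinear : bilinear_for *%R *%R weighted_form.
Proof.
split=> w; first exact: weighted_form_linear.
by move=> a u v; rewrite !(weighted_form_sym w) weighted_form_linear.
Qed.

HB.instance Definition _ := @bilinear_isBilinear.Build R (subspace_of V) (subspace_of V) R *%R *%R
  weighted_form weighted_form_bilinear.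

Lemma weighted_form_ge0 v : 0 <= weighted_form v v.
Proof.
apply: Rintegral_ge0 => x _; rewrite /wf hatM -expr2.
by rewrite mulr_ge0 ?sqr_ge0// weight_ge0.
Qed.

Definition weighted_seminorm : hilbertian_seminorm (subspace_of V) :=
  @HilbertianSeminorm R (subspace_of V)
    (fun v => Num.sqrt (weighted_form v v)) weighted_form
    weighted_form_sym weighted_form_ge0 (fun=> erefl).

Lemma weighted_seminorm_sqr v : ((weighted_seminorm v ^+ 2)%:E =
  \int[nu]_x ((ev v x) ^+ 2 * weight x)%:E)%E.
Proof.
rewrite hnorm_sqr /= /weighted_form /Rintegral fineK.
  by apply: eq_integral => x _; rewrite /wf hatM expr2.
exact: integrable_fin_num (wf_integrable v v).
Qed.

Local Notation p := weighted_seminorm.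

Lemma weighted_sqr_le v x : weight x * (ev v x) ^+ 2 <= q v ^+ 2.
Proof.
apply: weight_mul_le; [exact: sqr_ge0|exact: sqr_ge0|] => n /(_ v) nx.
rewrite mulrC -exprMn -[leLHS]ger0_norm ?sqr_ge0// normrX.
by rewrite lerXn2r ?nnegrE// mulr_ge0// hnorm_ge0.
Qed.

(** Bessel's inequality for the functional given by a q-continuous character. *)
Lemma weighted_bessel (E : {fset subspace_of V}) x : Defs.orthonormal q E ->
  weight x * \sum_(e <- E) (ev e x) ^+ 2 <= 1.
Proof.
move=> oE; apply: weight_mul_le => //; first by apply: sumr_ge0 => e _; exact: sqr_ge0.
move=> n nx; rewrite mul1r; set s := \sum_(e <- E) _.
have s0 : 0 <= s by apply: sumr_ge0 => e _; exact: sqr_ge0.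
pose v := \sum_(e <- E) ev e x *: e.
have qv : q v ^+ 2 = s by rewrite orthonormal_sqr// fset_uniq.
have vx : ev v x = s.
  rewrite /v raddf_sum -[hat x0 _ x]/((x : character A) _) raddf_sum.
  by apply: eq_bigr => e _; rewrite expr2; exact: (hatZ (ev e x) (\val e) x).
have := nx v; rewrite vx ger0_norm// => h.
have : s ^+ 2 <= n.+1%:R ^+ 2 * s.
  by rewrite -[in leRHS]qv -exprMn lerXn2r ?nnegrE// mulr_ge0// hnorm_ge0.
have [->|sn0] := eqVneq s 0; first by rewrite exprn_ge0.
by rewrite expr2 ler_pM2r// lt_neqAle eq_sym sn0.
Qed.

Lemma weighted_trace : (seminorm_trace p q < +oo)%E.
Proof.
apply: (@le_lt_trans _ _ 1%E); last exact: ltry.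
rewrite /seminorm_trace; case: ifPn => [_|/asboolP nker]; last first.
  exfalso; apply: nker => v qv; apply/eqP; rewrite -sqrf_eq0.
  apply/eqP/EFin_inj; rewrite weighted_seminorm_sqr.
  rewrite -[RHS](integral0 nu setT); apply: eq_integral => x _; congr (_%:E).
  apply/eqP; rewrite eq_le; apply/andP; split.
    by have := weighted_sqr_le v x; rewrite qv expr0n mulrC.
  by rewrite mulr_ge0 ?sqr_ge0// weight_ge0.
apply: ge_ereal_sup => _ [E oE <-].
rewrite -sumEFin; under eq_bigr do rewrite weighted_seminorm_sqr.
have mw e : measurable_fun setT
    (fun x : borel X => ((ev e x) ^+ 2 * weight x)%:E : \bar R).
  apply/measurable_EFinP; apply: measurable_funM; last exact: weight_measurable.
  by apply: measurable_funM; exact: hat_measurable.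
rewrite -ge0_integral_sum//; last first.
  by move=> e x _; rewrite lee_fin mulr_ge0 ?sqr_ge0// weight_ge0.
apply: (@le_trans _ _ (\int[nu]_x (cst 1%E x))%E); last first.
  by rewrite integral_cst// repr_setT mule1.
apply: ge0_le_integral => //.
- by move=> x _; apply: sume_ge0 => e _; rewrite lee_fin mulr_ge0 ?sqr_ge0// weight_ge0.
- by apply: emeasurable_sum => e; exact: mw.
- move=> x _; rewrite sumEFin lee_fin -mulr_suml mulrC; exact: weighted_bessel.
Qed.

Lemma weighted_markov n (v : subspace_of V) :
  (nu [set x | (1 <= `|ev v x|)%R] <=
   nu (~` norm_ball n) + (n.+1%:R ^+ 2 * p v ^+ 2)%:E)%E.
Proof.
pose B := [set x : borel X | 1 <= `|ev v x|].
have mB : measurable B.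
  rewrite -[X in measurable X]setTI.
  apply: (@measurable_fun_le _ (borel X) R setT (cst 1)) => //.
  by apply: measurableT_comp => //; exact: hat_measurable.
have mK := norm_ball_measurable n.
have mKC : measurable (~` norm_ball n : set (borel X)).
  exact: borel_open (norm_ballC_open n).
have mBK : measurable (B `&` norm_ball n) by exact: measurableI.
apply: (@le_trans _ _ (nu (~` norm_ball n `|` (B `&` norm_ball n)))).
  apply: le_measure; rewrite ?inE//; first exact: measurableU.
  by move=> x Bx; have [kx|nk] := pselect (norm_ball n x); [right|left].
apply: le_trans (measureU2 _ mKC mBK) _; rewrite leeD2l//.
have mF : measurable_fun setT
    (fun x : borel X => ((ev v x) ^+ 2 * weight x)%:E : \bar R).
  apply/measurable_EFinP; apply: measurable_funM; last exact: weight_measurable.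
  by apply: measurable_funM; exact: hat_measurable.
have F0 x : 0 <= (ev v x) ^+ 2 * weight x.
  by rewrite mulr_ge0 ?sqr_ge0// weight_ge0.
have c0 : 0 <= (n.+1%:R : R) ^+ 2 by rewrite exprn_ge0.
rewrite EFinM weighted_seminorm_sqr -ge0_integralZl//;
  last by move=> x _; rewrite lee_fin.
have := integral_indic nu measurableT mBK; rewrite setIT => E1.
rewrite -[leLHS]E1.
apply: ge0_le_integral => //.
- by apply/measurable_EFinP; exact: measurable_indic.
- by apply: measurable_funeM.
- move=> x _; rewrite indicE -EFinM lee_fin.
  have [/set_mem[/= Bx Kx]|_] := boolP (x \in B `&` norm_ball n); last first.
    by rewrite mulr_ge0.
  have evx : 1 <= (ev v x) ^+ 2.
    by rewrite -[leRHS]ger0_norm ?sqr_ge0// normrX exprn_ege1.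
  rewrite mulrCA; apply: le_trans evx _; rewrite ler_peMr ?sqr_ge0//.
  by rewrite -ler_pdivrMl ?exprn_gt0// mulr1 weight_lb.
Qed.

Lemma restriction_continuous (S : subalgClosed A) :
  continuous (char_res S : X -> charspace (char_res S x0)).
Proof.
move=> x; have FF := @fmap_filter _ _ (char_res S : X -> charspace (char_res S x0)) _ (nbhs_filter x).
apply: (cvg_charspace FF) => a.
suff : hat x0 (\val a) y @[y --> x] --> hat x0 (\val a) x by [].
exact: hat_continuous.
Qed.

Theorem representing_concentrated :
  exists p : hilbertian_seminorm (subspace_of V),
    (seminorm_trace p q < +oo)%E /\
    exists nu' : forall S : subalgClosed A,
        {measure set (borel (charspace (char_res S x0))) -> \bar R},
      (forall S, fin_gen_subalgs V S ->
        [/\ radon (nu' S), representing (nu' S) (L \o val)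
          & supported_in (nu' S) setT]) /\
      concentrated (fin_gen_subalgs V) p nu'.
Proof.
exists p; split; first exact: weighted_trace.
pose r S : borel X -> borel (charspace (char_res S x0)) := char_res S.
have mr S : measurable_fun setT (r S).
  by apply: continuous_borel; exact: restriction_continuous.
pose nu' S := image_measure nu (mr S).
have nu'E S B : nu' S B = nu (r S @^-1` B) by [].
exists nu'; split.
  move=> S _; split.
  - apply: (@radon_image _ _ _ nu (nu' S) setT (r S)) => //.
    + exact: charspace_hausdorff.
    + exact: charspace_hausdorff.
    + by rewrite setCT measure0.
    + by apply: continuous_subspaceT; exact: restriction_continuous.
    + by rewrite repr_setT ltry.
  - pose LS : {scalar subalgebra_of S} := L \o @subalgebra_incl R A S.
    apply: (@second_moments_representing _ _ _ (nu' S) LS) => //.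
      by rewrite nu'E preimage_setT repr_setT.
    move=> a.
    pose F (x : borel (charspace (char_res S x0))) : \bar R :=
      ((hat (char_res S x0) a x) ^+ 2)%:E.
    have mF : measurable_fun setT F.
      apply/measurable_EFinP; apply: continuous_borel_real.
      by apply: fun_continuous_sqr; exact: hat_continuous.
    have F0 : {in setT, forall x, (0 <= F x)%E}.
      by move=> x _; rewrite lee_fin sqr_ge0.
    have := ge0_integral_pushforward (mr S) nu measurableT mF F0.
    rewrite preimage_setT => /= E.
    suff : (\int[pushforward nu (r S)]_y F y <= (LS (a ^+ 2))%:E)%E by [].
    rewrite E; have [_ h] := nu_repr (\val (a ^+ 2)).
    rewrite -[(LS _)%:E]h le_eqVlt; apply/orP; left; apply/eqP.
    apply: eq_integral => x _; rewrite /F/=; congr (_%:E).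
    by rewrite expr2; exact: esym (hatM (\val a) (\val a) (x : X)).
  - by exists set0; split => //; rewrite ?setCT ?measure0.
move=> e e0; have e2 : 0 < e / 2 by rewrite divr_gt0.
have [n hn] := norm_ball_exhaust e2.
pose d := Num.sqrt (e / 2) / n.+1%:R.
exists d; first by rewrite divr_gt0// sqrtr_gt0.
move=> S JS v a va pv; rewrite nu'E.
rewrite (_ : _ @^-1` _ = [set x | (1 <= `|ev v x|)%R]); last first.
  by rewrite va.
apply: le_trans (weighted_markov n v) _.
rewrite [e]splitr EFinD leeD// lee_fin -exprMn.
have -> : e / 2 = (n.+1%:R * d) ^+ 2.
  by rewrite /d [_ * (_ / _)]mulrC divfK ?pnatr_eq0// sqr_sqrtr// ltW.
rewrite lerXn2r ?nnegrE ?ler_pM2l// mulr_ge0//; first exact: hnorm_ge0.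
by rewrite divr_ge0// sqrtr_ge0.
Qed.

End Forward.

(** * The characterization *)

Unset Implicit Arguments.

Theorem theorem2p5 (R : realType) (A : comAlgType R) (x0 : character A)
    (V : submodClosed A) (q : hilbertian_seminorm (subspace_of V))
    (L : {scalar A}) :
  generated_by [set` V] ->
  continuous_chars q x0 !=set0 ->
  L 1 = 1 ->
  (exists nu : {measure set (borel (charspace x0)) -> \bar R},
    [/\ radon nu, representing nu L & supported_in nu (continuous_chars q x0)])
  <->
  (exists p : hilbertian_seminorm (subspace_of V),
    (seminorm_trace p q < +oo)%E /\
    exists nu : forall S : subalgClosed A,
        {measure set (borel (charspace (char_res S x0))) -> \bar R},
      (forall S, fin_gen_subalgs V S ->
        [/\ radon (nu S), representing (nu S) (L \o val)
          & supported_in (nu S) setT]) /\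
      concentrated (fin_gen_subalgs V) p nu).
Proof.
move=> genV _ L1; split=> [[nu [rnu repr supp]]|[p [trp [nu [nuJ nuC]]]]].
  exact: representing_concentrated L1 rnu repr supp.
by apply: concentrated_representing genV L1 trp _ nuC => S /nuJ[].
Qed.
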